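(* Let $n\geq 1$ be an integer, and let $q\equiv 1\pmod n$ be a prime power. Let $\alpha\in\overline{\mathbb{F}_q(T)}$ be a root of the polynomial $$T^nx^n(x^q-x)^n-(x^q-x)^n+T^n\in\mathbb{F}_q(T)[x].$$ Then $\alpha$ is totally $T$-adic with height $1/(q+1)$ and gonality $n$.
   Context: $\mathbb{F}_q(T)$ is the rational function field, $\overline{\mathbb{F}_q(T)}$ a fixed algebraic closure, and $\mathbb{F}_q((T))$ the field of formal Laurent series. The minimal polynomial of $\alpha\in\overline{\mathbb{F}_q(T)}$ is the unique polynomial $f\in\mathbb{F}_q[T][x]$ that is irreducible over $\mathbb{F}_q(T)$ as a polynomial in $x$, satisfies $f(\alpha)=0$, has coefficients in $\mathbb{F}_q[T]$ with no common factor, and whose leading coefficient (in $x$) is a monic polynomial in $T$. The height is $h(\alpha)=\deg_T(f)/\deg_x(f)$. An element $\alpha$ is totally $T$-adic if its minimal polynomial splits completely over $\mathbb{F}_q((T))$. The gonality of a curve $X/\mathbb{F}_q$ is the minimum degree of a nonconstant $\mathbb{F}_q$-morphism $X\to\mathbb{P}^1$; the gonality of $\alpha$ is the gonality of the smooth proper curve over $\mathbb{F}_q$ with function field $\mathbb{F}_q(T,\alpha)$. *)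

(* Defs.v *)
From HB Require Import structures.
From mathcomp Require Import all_boot all_order all_algebra.
From mathcomp Require Import boolp classical_sets.

Set Implicit Arguments.
Unset Strict Implicit.
Unset Printing Implicit Defensive.

Import GRing.Theory.
Local Open Scope ring_scope.

Section PowerSeries.
Variable R : idomainType.

(* A wrapper is needed: nat -> R already carries the pointwise product. *)
Record fps := Fps { fpscoef : nat -> R }.

HB.instance Definition _ := gen_eqMixin fps.
HB.instance Definition _ := gen_choiceMixin fps.

Implicit Types f g h : fps.

Lemma fpsP f g : fpscoef f =1 fpscoef g -> f = g.
Proof. by case: f g => [f] [g] /= fg; congr Fps; apply/funext. Qed.

Definition fps_zero := Fps (fun=> 0).
Definition fps_opp f := Fps (fun k => - fpscoef f k).
Definition fps_add f g := Fps (fun k => fpscoef f k + fpscoef g k).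

Fact fps_addA : associative fps_add.
Proof. by move=> f g h; apply: fpsP => k /=; rewrite addrA. Qed.
Fact fps_addC : commutative fps_add.
Proof. by move=> f g; apply: fpsP => k /=; rewrite addrC. Qed.
Fact fps_add0 : left_id fps_zero fps_add.
Proof. by move=> f; apply: fpsP => k /=; rewrite add0r. Qed.
Fact fps_addN : left_inverse fps_zero fps_opp fps_add.
Proof. by move=> f; apply: fpsP => k /=; rewrite addNr. Qed.

HB.instance Definition _ :=
  GRing.isZmodule.Build fps fps_addA fps_addC fps_add0 fps_addN.

Definition fps_of_poly (p : {poly R}) := Fps (fun k => p`_k).
Definition fps_trunc n f : {poly R} := \poly_(i < n) fpscoef f i.

Definition fps_mul f g :=
  Fps (fun k => \sum_(i < k.+1) fpscoef f i * fpscoef g (k - i)).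

Lemma fpscoef_mul (n k : nat) f g : (k < n)%N ->
  fpscoef (fps_mul f g) k = (fps_trunc n f * fps_trunc n g)`_k.
Proof.
move=> kn; rewrite coefM; apply: eq_bigr => i _ /=.
rewrite !coef_poly (leq_ltn_trans _ kn) ?(leq_ltn_trans _ kn) ?leq_subr //.
by rewrite -ltnS.
Qed.

Lemma coefM_congr (k : nat) (p p' r r' : {poly R}) :
  (forall i, (i <= k)%N -> p`_i = p'`_i) ->
  (forall i, (i <= k)%N -> r`_i = r'`_i) -> (p * r)`_k = (p' * r')`_k.
Proof.
move=> pp rr; rewrite !coefM; apply: eq_bigr => i _.
by rewrite pp ?rr ?leq_subr // -ltnS.
Qed.

Lemma coef_fps_trunc_mul (n k : nat) f g : (k < n)%N ->
  (fps_trunc n (fps_mul f g))`_k = (fps_trunc n f * fps_trunc n g)`_k.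
Proof. by move=> kn; rewrite coef_poly kn (fpscoef_mul f g kn). Qed.

Fact fps_mulA : associative fps_mul.
Proof.
move=> f g h; apply: fpsP => k.
rewrite !(fpscoef_mul _ _ (ltnSn k)).
rewrite (@coefM_congr k _ (fps_trunc k.+1 f) _
          (fps_trunc k.+1 g * fps_trunc k.+1 h)) //; last first.
  by move=> i ik; rewrite coef_fps_trunc_mul.
rewrite mulrA; apply: coefM_congr => // i ik.
by rewrite coef_fps_trunc_mul.
Qed.

Fact fps_mulC : commutative fps_mul.
Proof.
by move=> f g; apply: fpsP => k; rewrite !(fpscoef_mul _ _ (ltnSn k)) mulrC.
Qed.

Fact fps_mul1 : left_id (fps_of_poly 1) fps_mul.
Proof.
move=> f; apply: fpsP => k /=; rewrite big_ord_recl /= coef1 eqxx mul1r subn0.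
by rewrite big1 ?addr0 // => i _; rewrite coef1 mul0r.
Qed.

Fact fps_mulDl : left_distributive fps_mul fps_add.
Proof.
move=> f g h; apply: fpsP => k /=; rewrite -big_split /=.
by apply: eq_bigr => i _; rewrite mulrDl.
Qed.

Fact fps_one_neq0 : fps_of_poly 1 != fps_zero.
Proof.
apply/eqP => /(congr1 (fun f => fpscoef f 0)) /= /eqP.
by rewrite coef1 eqxx oner_eq0.
Qed.

HB.instance Definition _ := GRing.Zmodule_isComNzRing.Build fps
  fps_mulA fps_mulC fps_mul1 fps_mulDl fps_one_neq0.

Definition fps_unit : {pred fps} := fun f => `[< exists g, g * f = 1 >].
Definition fps_inv f : fps :=
  if pselect (exists g, g * f = 1) is left e then projT1 (cid e) else f.

Fact fps_mulV : {in fps_unit, left_inverse 1 fps_inv *%R}.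
Proof.
move=> f /asboolP uf; rewrite /fps_inv; case: pselect => // e.
by case: cid.
Qed.
Fact fps_unitP f g : g * f = 1 -> fps_unit f.
Proof. by move=> gf; apply/asboolP; exists g. Qed.
Fact fps_inv_out : {in [predC fps_unit], fps_inv =1 id}.
Proof.
by move=> f /asboolP nuf; rewrite /fps_inv; case: pselect.
Qed.

HB.instance Definition _ := GRing.ComNzRing_hasMulInverse.Build fps
  fps_mulV fps_unitP fps_inv_out.

Lemma fps_neq0_order f : f != 0 -> exists2 m : nat,
  fpscoef f m != 0 & forall i, (i < m)%N -> fpscoef f i = 0.
Proof.
move=> f0; have /ex_minnP[m fm mmin] : exists m, fpscoef f m != 0.
  apply: contrapT => /forallNP nf; case/eqP: f0; apply: fpsP => k.
  by apply/eqP/negP => /negP; apply: nf.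
by exists m => // i im; apply/eqP; apply: contraLR im => /mmin; rewrite -leqNgt.
Qed.

Fact fps_mulf_eq0 f g : f * g = 0 -> (f == 0) || (g == 0).
Proof.
move=> fg0; apply/norP => -[/fps_neq0_order[a fa fmin]].
case/fps_neq0_order=> b gb gmin.
have := congr1 (fun h => fpscoef h (a + b)) fg0; rewrite /= => /eqP.
have ltab : (a < (a + b).+1)%N by rewrite ltnS leq_addr.
rewrite (bigD1 (Ordinal ltab)) //= addKn big1 ?addr0 => [|i].
  by rewrite mulf_eq0 (negPf fa) (negPf gb).
rewrite -val_eqE /= neq_ltn => /orP[/fmin->|ai]; first by rewrite mul0r.
rewrite gmin ?mulr0 // ltn_subLR; first by rewrite ltn_add2r.
by rewrite -ltnS.
Qed.

HB.instance Definition _ := GRing.ComUnitRing_isIntegral.Build fps fps_mulf_eq0.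

Fact fps_of_poly_additive : zmod_morphism fps_of_poly.
Proof. by move=> p r; apply: fpsP => k /=; rewrite coefB. Qed.
Fact fps_of_poly_multiplicative : monoid_morphism fps_of_poly.
Proof. by split=> // p r; apply: fpsP => k /=; rewrite coefM. Qed.

HB.instance Definition _ := GRing.isZmodMorphism.Build {poly R} fps fps_of_poly
  fps_of_poly_additive.
HB.instance Definition _ := GRing.isMonoidMorphism.Build {poly R} fps fps_of_poly
  fps_of_poly_multiplicative.

End PowerSeries.

Notation ratfun F := {fraction {poly F}}.

(* F((T)) as the field of fractions of F[[T]] *)
Notation laurent F := {fraction (fps F)}.

Definition laurent_of_poly (F : fieldType) : {poly F} -> laurent F :=
  @tofrac (fps F) \o @fps_of_poly F.

HB.instance Definition _ (F : fieldType) :=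
  GRing.RMorphism.on (@laurent_of_poly F).

Section TotallyTadic.
Variables (F : finFieldType) (Omega : closedFieldType).
Variable iota : {rmorphism ratfun F -> Omega}.
Implicit Types (alpha z : Omega) (f : {poly {poly F}}).

(* In f : {poly {poly F}}, the outer variable is x and the inner one is T. *)
Definition is_minpoly alpha f : Prop :=
  [/\ irreducible_poly (map_poly (@tofrac {poly F}) f),
      root (map_poly (iota \o @tofrac {poly F}) f) alpha,
      (forall d : {poly F}, (forall i, d %| f`_i) -> d %= 1)
    & lead_coef f \is monic].

Definition deg_T f : nat := (sizeY f).-1.
Definition deg_x f : nat := (size f).-1.

Definition splits_over_laurent f : Prop :=
  exists rs : seq (laurent F),
    map_poly (@laurent_of_poly F) f %= \prod_(r <- rs) ('X - r%:P).

Definition totally_Tadic alpha : Prop :=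
  exists2 f, is_minpoly alpha f & splits_over_laurent f.

Definition has_height alpha (h : rat) : Prop :=
  exists2 f, is_minpoly alpha f & h = (deg_T f)%:R / (deg_x f)%:R.

Definition const_embed (c : F) : Omega := iota (@tofrac {poly F} c%:P).

(* F(S), the subfield of Omega generated by the constants F and by S *)
Definition subfield_gen (S : set Omega) : set Omega :=
  smallest (fun K : set Omega => divring_closed [in K])
    (range const_embed `|` S)%classic.

(* [K : E] = d, for subfields E `<=` K of Omega *)
Definition has_degree (E K : set Omega) (d : nat) : Prop :=
  exists2 b : 'I_d -> Omega, (forall i, K (b i)) &
    forall z, K z -> exists! c : {ffun 'I_d -> Omega},
      (forall i, E (c i)) /\ z = \sum_(i < d) c i * b i.

(* The function field F(T, alpha) of the curve attached to alpha *)
Definition function_field alpha : set Omega :=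
  subfield_gen [set iota (@tofrac {poly F} 'X); alpha]%classic.

(* An F-morphism from the smooth proper curve X with function field K to P^1
   is the same as an element phi of K (or the constant map to infinity); it is
   nonconstant iff phi is transcendental over F, and its degree is then, by
   definition, the degree [K : F(phi)] of the function field extension. *)
Definition has_map_of_degree alpha (d : nat) : Prop :=
  exists phi : Omega, [/\ function_field alpha phi,
    ~ algebraicOver const_embed phi &
    has_degree (subfield_gen [set phi]%classic) (function_field alpha) d].

Definition has_gonality alpha (m : nat) : Prop :=
  has_map_of_degree alpha m /\
  forall d, has_map_of_degree alpha d -> (m <= d)%N.

End TotallyTadic.

(* Main.v *)
Require Import Defs.
From HB Require Import structures.
From mathcomp Require Import all_boot all_order all_algebra.
From mathcomp Require Import all_solvable all_field.
From mathcomp Require Import boolp classical_sets ring.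
Import GRing.Theory.
Local Open Scope ring_scope.

Set Implicit Arguments.
Unset Strict Implicit.
Unset Printing Implicit Defensive.

(** Write y = x^q - x.  The equation reads t^n (1 + (x y)^n) = y^n, so over
    F(x) the coordinate t is an n-th root of a = y^n / (1 + (x y)^n).  As
    n | q - 1, the field F contains the n-th roots of unity, and Kummer theory
    ([Kummer_irreducible]) makes X^n - a irreducible as soon as a is not an e-th
    power for any e with 1 < e | n.  If it were, then 1 + (x y)^n would be an e-th power
    s^e in F(x), hence in F[x]; but s^e - ((x y)^(n/e))^e, which is 1, splits
    over F into the factors s - w (x y)^(n/e), with w^e = 1, all of which would be
    constants, so that x y would be constant too ([not_power]).

    Hence K = F(x, t) has degree n over F(x), and each solution (x, t) of the
    equation in a field E, with t transcendental over F, gives an embedding of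
    K into E ([curve_function_field]).  One such embedding is K -> Omega, with
    (x, t) = (alpha, T).  By Hensel's lemma there are n (q + 1) more, into
    F((T)), with t = T: n of them for each value in P^1(F) of x at T = 0, namely
    x = c - w T + ... and x = w / T + ... with w^n = 1 ([curve_points]).  They are
    the n (q + 1) places of K above T = 0.

    Applying these embeddings to a polynomial relation over F(T) satisfied by
    alpha shows that the relation has at least n (q + 1) roots
    ([alpha_degree]).  As the given polynomial has degree n (q + 1) in x, it is
    irreducible, it splits over F((T)), and the height is
    n / (n (q + 1)).

    The function x has degree n.  Conversely let psi in K be nonconstant with
    [K : F(psi)] = d < n.  Each of the n (q + 1) places is rational, so it sends
    psi to one of the q + 1 points of P^1(F), and some d + 1 places send psi to
    the same point, which a change of coordinate on P^1 moves to 0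
    ([many_zeros]).  Weak approximation gives beta_0, ..., beta_d in K with
    beta_j equal to 1 at the j-th of these places and to 0 at the others
    ([separating_polys]).  Reducing a linear relation among them at these
    places shows that they are independent over F(psi)
    ([ratfun_independent]), which contradicts the degree d. *)

(** * Rational functions and transcendental elements *)

Section FractionLift.
Variable R : idomainType.
Implicit Types (z : {fraction R}) (a b d : R).

Lemma fraction_ratio z : exists a b, b != 0 /\ z = tofrac a / tofrac b.
Proof.
elim/quotW: z => w; exists w.1, w.2; split; first exact: denom_ratioP.
have d0 : tofrac w.2 != 0 :> {fraction R}.
  by rewrite tofrac_eq0; apply: denom_ratioP.
apply: (mulIf d0); rewrite divfK //; apply/eqP.
rewrite /GRing.mul /= !piE /FracField.equivf /FracField.mulf.
by rewrite !numden_Ratio ?mulf_neq0 ?oner_neq0 ?denom_ratioP // !mulr1 mulrC.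
Qed.

Variables (E : fieldType) (j : {rmorphism R -> E}).
Hypothesis j_inj : injective j.

Let j_neq0 b : b != 0 -> j b != 0.
Proof. by apply: contraNneq => jb0; apply/eqP/j_inj; rewrite jb0 rmorph0. Qed.

(** Stated as an existence, so that later proofs never unfold the quotient
    construction of the field of fractions. *)
Lemma fraction_extension :
  exists s : {rmorphism {fraction R} -> E}, forall a, s (tofrac a) = j a.
Proof.
have num z : exists ab : R * R,
    ab.2 != 0 /\ z = tofrac ab.1 / tofrac ab.2.
  by have [a [b ?]] := fraction_ratio z; exists (a, b).
have [nd ndP] := choice num.
pose s z := j (nd z).1 / j (nd z).2.
have sE a b : b != 0 -> s (tofrac a / tofrac b) = j a / j b.
  move=> b0; rewrite /s; have [d0 /eqP] := ndP (tofrac a / tofrac b).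
  set u := (nd _).1; set v := (nd _).2 in d0 *.
  rewrite eqr_div ?tofrac_eq0 // -!tofracM tofrac_eq => /eqP auv.
  apply/eqP; rewrite eqr_div ?j_neq0 // -!rmorphM; apply/eqP; congr (j _).
  exact/esym.
have sB : zmod_morphism s.
  move=> z w; have [a [b [b0 ->]]] := fraction_ratio z.
  have [c [d [d0 ->]]] := fraction_ratio w.
  rewrite -mulNr addf_div ?tofrac_eq0 // -tofracN -!tofracM -tofracD.
  rewrite !sE ?mulf_neq0 // -[X in _ = _ + X]mulNr addf_div ?j_neq0 //.
  by rewrite rmorphD !rmorphM rmorphN.
have sM : monoid_morphism s.
  split=> [|z w].
    have -> : (1 : {fraction R}) = tofrac 1 / tofrac 1 by rewrite rmorph1 divr1.
    by rewrite sE ?oner_neq0 // rmorph1 divr1.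
  have [a [b [b0 ->]]] := fraction_ratio z.
  have [c [d [d0 ->]]] := fraction_ratio w.
  rewrite mulf_div -!tofracM !sE ?mulf_neq0 // !rmorphM.
  by rewrite mulf_div.
pose A := GRing.isZmodMorphism.Build _ _ s sB.
pose B := GRing.isMonoidMorphism.Build _ _ s sM.
pose S : {rmorphism {fraction R} -> E} := HB.pack s A B.
by exists S => a; rewrite /= -[tofrac a]divr1 -tofrac1 sE ?oner_neq0 ?rmorph1 ?divr1.
Qed.

End FractionLift.

Lemma fraction_morph_eq (R : idomainType) (E : fieldType)
    (s s' : {rmorphism {fraction R} -> E}) :
  (forall a, s (tofrac a) = s' (tofrac a)) -> s =1 s'.
Proof.
move=> ss z; have [a [b [_ ->]]] := fraction_ratio z.
by rewrite !fmorph_div !ss.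
Qed.

Section Transcendental.
Variables (F E : fieldType) (c : {rmorphism F -> E}).

Definition transcendental (x : E) := ~ algebraicOver c x.

(** Transcendence is what makes evaluation at [x] injective on polynomials, hence
    extendable to their fractions. *)
Lemma transcendental_ext x : transcendental x ->
  exists s : {rmorphism ratfun F -> E},
    s (tofrac 'X) = x /\ forall a, s (tofrac a%:P) = c a.
Proof.
move=> trx.
have inj : injective (horner_eval x \o map_poly c).
  apply: raddf_inj => p /= px0; apply/eqP/negP => /negP p0.
  by apply: trx; exists p => //; apply/rootP.
have [s sE] := fraction_extension inj.
by exists s; split=> [|a]; rewrite sE /= /horner_eval ?map_polyX ?map_polyC ?hornerE.
Qed.

End Transcendental.

Lemma ratfun_morph_tofrac (F E : fieldType) (s : {rmorphism ratfun F -> E})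
    (c : {rmorphism F -> E}) (p : {poly F}) :
  (forall a, s (tofrac a%:P) = c a) ->
  s (tofrac p) = (map_poly c p).[s (tofrac 'X)].
Proof.
move=> sc; elim/poly_ind: p => [|p a IH]; first by rewrite !rmorph0 horner0.
by rewrite !(rmorphD, rmorphM) /= sc IH map_polyX map_polyC !hornerE.
Qed.

Lemma ratfun_morph_eq (F E : fieldType) (s s' : {rmorphism ratfun F -> E}) :
  s (tofrac 'X) = s' (tofrac 'X) ->
  (forall a, s (tofrac a%:P) = s' (tofrac a%:P)) -> s =1 s'.
Proof.
move=> sX sc; apply: fraction_morph_eq => p.
elim/poly_ind: p => [|p a IH]; first by rewrite !rmorph0.
by rewrite !(rmorphD, rmorphM) /= sc IH sX.
Qed.

Lemma transcendental_morph (F E E' : fieldType) (c : {rmorphism F -> E})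
    (s : {rmorphism E -> E'}) (x : E) :
  transcendental (s \o c) (s x) <-> transcendental c x.
Proof.
split=> trx [p p0 px]; apply: trx; exists p => //.
  by rewrite map_poly_comp fmorph_root.
by move: px; rewrite map_poly_comp fmorph_root.
Qed.

Lemma transcendental_tofracX (F : fieldType) :
  transcendental (@tofrac {poly F} \o polyC) (tofrac 'X).
Proof.
case=> p p0 /rootP; rewrite map_poly_comp horner_map /= => /eqP.
by rewrite tofrac_eq0 -[_.[_]]/(p \Po 'X) comp_polyXr (negPf p0).
Qed.

(** * Power series and Hensel's lemma *)

Lemma horner_addr (R : comNzRingType) (p : {poly R}) (a e : R) :
  exists b, p.[a + e] = p.[a] + e * p^`().[a] + e ^+ 2 * b.
Proof.
elim/poly_ind: p => [|p c [b IH]].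
  by exists 0; rewrite deriv0 !horner0 !mulr0 !addr0.
exists (b * (a + e) + p^`().[a]).
by rewrite derivD derivM derivX derivC !hornerE IH; ring.
Qed.

Section PowerSeries.
Variable F : fieldType.
Implicit Types (f g : fps F) (c : F).

Definition fps0 f : F := fpscoef f 0.

#[global] Arguments fps0 : simpl never.

Fact fps0_additive : zmod_morphism fps0. Proof. by []. Qed.
Fact fps0_multiplicative : monoid_morphism fps0.
Proof. by split=> [|f g]; rewrite /fps0 /= ?coef1 // big_ord1. Qed.
HB.instance Definition _ := GRing.isZmodMorphism.Build _ _ fps0 fps0_additive.
HB.instance Definition _ :=
  GRing.isMonoidMorphism.Build _ _ fps0 fps0_multiplicative.

Definition fpsX : fps F := fps_of_poly 'X.

Lemma fps0_polyE (p : {poly F}) : fps0 (fps_of_poly p) = p`_0.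
Proof. by []. Qed.

Lemma fpscoef_mulXn m f k :
  fpscoef (fpsX ^+ m * f) k = if (k < m)%N then 0 else fpscoef f (k - m).
Proof.
have -> : fpsX ^+ m = fps_of_poly 'X^m by rewrite rmorphXn.
rewrite [LHS](fpscoef_mul _ _ (ltnSn k)).
rewrite (@coefM_congr _ k _ 'X^m _ (fps_trunc k.+1 f)) //; last first.
  by move=> i ik; rewrite coef_poly ltnS ik.
by rewrite coefXnM coef_poly ltnS leq_subr.
Qed.

Lemma fpscoefD f g k : fpscoef (f + g) k = fpscoef f k + fpscoef g k.
Proof. by []. Qed.

Lemma fpsXn_dvd m f : (forall i, (i < m)%N -> fpscoef f i = 0) ->
  exists g, f = fpsX ^+ m * g.
Proof.
move=> f0; exists (Fps (fun k => fpscoef f (k + m))); apply: fpsP => k.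
by rewrite fpscoef_mulXn; case: ltnP => [/f0 // | mk] /=; rewrite subnK.
Qed.

(** The truncations of [f] approximate it in the T-adic topology. *)
Lemma fpsXn_trunc m f : exists g, f - fps_of_poly (fps_trunc m f) = fpsX ^+ m * g.
Proof.
by apply: fpsXn_dvd => i im /=; rewrite coef_poly im subrr.
Qed.

Lemma fpsX_neq0 : fpsX != 0.
Proof.
apply/eqP => /(congr1 (fun f => fpscoef f 1)) /=; rewrite coefX eqxx.
by move/eqP; rewrite oner_eq0.
Qed.

Lemma fps0X : fps0 fpsX = 0.
Proof. by rewrite /fps0 /= coefX. Qed.

Lemma fps_order f : f != 0 -> exists m g, f = fpsX ^+ m * g /\ fps0 g != 0.
Proof.
case/fps_neq0_order => m fm /fpsXn_dvd[g fE]; exists m, g; split=> //.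
by move: fm; rewrite fE fpscoef_mulXn ltnn subnn.
Qed.

(** The coefficients of the root are found one at a time: adding a multiple of
    T^k to an approximate root changes the value by P' times that multiple,
    modulo T^(k+1), and P' is invertible at the residue. *)
Lemma fps_hensel (P : {poly fps F}) (c : F) :
  root (map_poly fps0 P) c -> ~~ root (map_poly fps0 P)^`() c ->
  exists r, P.[r] = 0 /\ fps0 r = c.
Proof.
move=> Pc dPc; set d := (map_poly fps0 P)^`().[c] in dPc.
(* The correction of degree k is the only choice that kills the coefficient k
   of the value. *)
pose step k (p : {poly F}) : {poly F} :=
  p - (fpscoef P.[fps_of_poly p] k / d) *: 'X^k.
pose a := fix a k := if k is k'.+1 then step k'.+1 (a k') else c%:P.
have a0 k : (a k)`_0 = c.
  elim: k => [|k IH] /=; first by rewrite coefC.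
  by rewrite coefB coefZ coefXn mulr0 subr0.
have root_a k : forall i, (i <= k)%N -> fpscoef P.[fps_of_poly (a k)] i = 0.
  elim: k => [|k IH] i.
    rewrite leqn0 => /eqP-> /=; rewrite [LHS](_ : _ = fps0 P.[fps_of_poly c%:P]) //.
    by rewrite -horner_map /= fps0_polyE coefC; apply/rootP.
  move=> ik /=; rewrite /step; set e := fpscoef _ k.+1.
  pose E := fpsX ^+ k.+1 * fps_of_poly (- (e / d))%:P.
  have -> : fps_of_poly (a k - (e / d) *: 'X^(k.+1)) = fps_of_poly (a k) + E.
    rewrite /E -mul_polyC polyCN rmorphB rmorphM rmorphXn rmorphN /= mulrN.
    by rewrite [_ * fpsX ^+ _]mulrC.
  have [b ->] := horner_addr P (fps_of_poly (a k)) E.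
  rewrite -[E * _]mulrA.
  (* The second order term starts in degree 2k + 2, beyond k + 1. *)
  have -> : E ^+ 2 * b = fpsX ^+ (k.+1 + k.+1)
      * (fps_of_poly (- (e / d))%:P ^+ 2 * b).
    by rewrite /E exprMn mulrA -exprM exprD mulnC mul2n -addnn exprD.
  rewrite !fpscoefD !fpscoef_mulXn.
  have -> : (i < k.+1 + k.+1)%N by rewrite (leq_ltn_trans ik) // addnS ltnS leq_addr.
  rewrite addr0.
  move: ik; rewrite leq_eqVlt => /predU1P[->|]; last first.
    by move=> ik; rewrite ik addr0 IH.
  rewrite ltnn subnn [X in _ + X](_ : _ = fps0 (fps_of_poly (- (e / d))%:P
    * P^`().[fps_of_poly (a k)])) //.
  rewrite rmorphM /= -horner_map /= -deriv_map !fps0_polyE coefC eqxx a0.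
  by rewrite -/d mulNr divfK ?subrr.
have a_stable m i k : (i <= k)%N -> (a (k + m)%N)`_i = (a k)`_i.
  move=> ik; elim: m => [|m IH]; first by rewrite addn0.
  rewrite addnS /= /step coefB coefZ coefXn IH ltn_eqF ?mulr0 ?subr0 //.
  by rewrite ltnS (leq_trans ik) ?leq_addr.
pose r := Fps (fun k => (a k)`_k).
have ra k : exists g, r = fps_of_poly (a k) + fpsX ^+ k.+1 * g.
  have [|g rg] := @fpsXn_dvd k.+1 (r - fps_of_poly (a k)).
    move=> i ik /=; have := a_stable (k - i)%N i i (leqnn _).
    by rewrite subnKC => [->|//]; rewrite subrr.
  by exists g; rewrite -rg addrC subrK.
exists r; split; last by rewrite /fps0 /= coefC.
apply: fpsP => k; have [g ->] := ra k.
have [b ->] := horner_addr P (fps_of_poly (a k)) (fpsX ^+ k.+1 * g).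
rewrite -addrA fpscoefD root_a // expr2 -!mulrA -mulrDr fpscoef_mulXn ltnSn.
by rewrite addr0.
Qed.
End PowerSeries.

(** * Residues of Laurent series and weak approximation *)

Lemma horner_map_MXaddC (R S : comNzRingType) (f : {rmorphism R -> S}) p c x :
  (map_poly f (p * 'X + c%:P)).[x] = (map_poly f p).[x] * x + f c.
Proof. by rewrite rmorphD rmorphM /= map_polyX map_polyC hornerMXaddC. Qed.

Lemma interpolation_basis (E : fieldType) m (r : 'I_m -> E) (i : 'I_m) :
  injective r -> exists p : {poly E}, forall j, p.[r j] = (j == i)%:R.
Proof.
move=> r_inj; exists (\prod_(k < m | k != i) ((r i - r k)^-1 *: ('X - (r k)%:P))).
move=> j; rewrite horner_prod; have [->|ji] := eqVneq j i.
  rewrite big1 // => k ki; rewrite hornerZ hornerXsubC mulVf // subr_eq0.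
  by rewrite (inj_eq r_inj) eq_sym.
by rewrite (bigD1 j) //= hornerZ hornerXsubC subrr mulr0 mul0r.
Qed.

Section Residue.
Variable F : fieldType.
Local Notation L := (laurent F).
Implicit Types (z w : L) (c d : F).

(** Membership in the valuation ring F[[T]] and reduction modulo T, in one
    relation. *)
Definition has_residue z c := exists g : fps F, z = tofrac g /\ fps0 g = c.

Lemma residue_uniq z c d : has_residue z c -> has_residue z d -> c = d.
Proof.
by case=> [g [-> <-]] [h [/eqP]]; rewrite tofrac_eq => /eqP-> <-.
Qed.

Lemma residueD z w c d :
  has_residue z c -> has_residue w d -> has_residue (z + w) (c + d).
Proof.
by move=> [g [-> <-]] [h [-> <-]]; exists (g + h); rewrite !rmorphD.
Qed.

Lemma residueB z w c d :
  has_residue z c -> has_residue w d -> has_residue (z - w) (c - d).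
Proof.
by move=> [g [-> <-]] [h [-> <-]]; exists (g - h); rewrite !rmorphB.
Qed.

Lemma residueM z w c d :
  has_residue z c -> has_residue w d -> has_residue (z * w) (c * d).
Proof.
by move=> [g [-> <-]] [h [-> <-]]; exists (g * h); rewrite !rmorphM.
Qed.

Lemma residue_sum (I : finType) (f : I -> L) (e : I -> F) :
  (forall i, has_residue (f i) (e i)) -> has_residue (\sum_i f i) (\sum_i e i).
Proof.
move=> fe; elim/big_rec2: _ => [|i c z _ zc]; last exact: residueD.
by exists 0; rewrite !rmorph0.
Qed.

Lemma residue_poly (p : {poly F}) : has_residue (laurent_of_poly p) p`_0.
Proof. by exists (fps_of_poly p). Qed.

Lemma residueC c : has_residue (laurent_of_poly c%:P) c.
Proof. by have := residue_poly c%:P; rewrite coefC. Qed.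

Lemma residue_horner (p : {poly F}) z c : has_residue z c ->
  has_residue (map_poly (@laurent_of_poly F \o polyC) p).[z] p.[c].
Proof.
move=> zc; elim/poly_ind: p => [|p a IH].
  by rewrite map_poly0 !horner0; exists 0; rewrite !rmorph0.
rewrite horner_map_MXaddC hornerMXaddC.
by apply: residueD (residueC a); apply: residueM.
Qed.

Definition lX : L := laurent_of_poly 'X.

Lemma lX_neq0 : lX != 0.
Proof. by rewrite tofrac_eq0 fpsX_neq0. Qed.

(** A series with nonzero constant coefficient is inverted by solving the linear
    equation g X = 1 with Hensel's lemma. *)
Lemma fps_inverse (g : fps F) : fps0 g != 0 ->
  exists h, (tofrac g)^-1 = tofrac h :> L.
Proof.
move=> g0; have [|| h [/eqP]] := @fps_hensel F (g *: 'X - 1) (fps0 g)^-1.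
- rewrite rmorphB rmorph1 /= map_polyZ map_polyX rootE !hornerE.
  by rewrite mulfV // subrr.
- rewrite rmorphB rmorph1 /= map_polyZ map_polyX rootE.
  by rewrite derivB derivZ derivX derivC !hornerE subr0.
rewrite !hornerE subr_eq0 => /eqP gh _; exists h.
have g1 : tofrac g != 0 :> L.
  by rewrite tofrac_eq0; apply: contraNneq g0 => ->; rewrite rmorph0.
by apply: (mulfI g1); rewrite mulfV // -tofracM gh tofrac1.
Qed.

(** Nonzero power series are powers of T times units, so a nonzero quotient of
    two of them is a unit times a power of T, positive or negative; the latter
    is kept as a quotient to stay within natural exponents. *)
Lemma laurent_valuation z : exists m k g,
  z = tofrac g * lX ^+ m / lX ^+ k /\ (z != 0 -> fps0 g != 0).
Proof.
have [->|z0] := eqVneq z 0.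
  by exists 0, 0, 0; rewrite rmorph0 !mul0r; split=> //; rewrite eqxx.
have [a [b [b0 zE]]] := fraction_ratio z.
have a0 : a != 0 by apply: contraNneq z0 => a0; rewrite zE a0 rmorph0 mul0r.
have [m [g [aE g0]]] := fps_order a0; have [k [h [bE h0]]] := fps_order b0.
have [h' hh'] := fps_inverse h0; exists m, k, (g * h'); split=> [|_].
  rewrite zE aE bE !tofracM !tofracXn -hh' invfM.
  by rewrite -/lX; ring.
rewrite rmorphM mulf_neq0 //; apply/eqP => h'0.
have hh : h * h' = 1.
  apply/eqP; rewrite -(@tofrac_eq (fps F)) tofracM tofrac1 -hh' mulfV //.
  by rewrite tofrac_eq0; apply: contraNneq h0 => ->; rewrite rmorph0.
move/(congr1 (@fps0 F))/eqP: hh; rewrite rmorphM h'0 mulr0 rmorph1 eq_sym.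
by rewrite oner_eq0.
Qed.

(** The valuative criterion: each point of P^1(F((T))) reduces to a point of
    P^1(F). *)
Lemma residue_or_pole z :
  (exists c, has_residue z c) \/ z != 0 /\ has_residue z^-1 0.
Proof.
have [m [k [g [zE g0]]]] := laurent_valuation z.
have [z0|z0] := eqVneq z 0.
  by left; exists 0; exists 0; rewrite z0 !rmorph0.
case: (leqP k m) => [km|mk].
  left; exists (fps0 (g * fpsX F ^+ (m - k))); exists (g * fpsX F ^+ (m - k)).
  rewrite zE tofracM tofracXn -/lX -mulrA; split=> //; congr (_ * _).
  by rewrite -{1}(subnK km) exprD mulfK // expf_neq0 // lX_neq0.
right; split=> //; have [h gh] := fps_inverse (g0 z0).
exists (fpsX F ^+ (k - m) * h); split; last first.
  by rewrite rmorphM rmorphXn /= fps0X expr0n subn_eq0 leqNgt mk mul0r.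
rewrite zE tofracM tofracXn -/lX -gh -{1}(subnK (ltnW mk)) exprD.
have : lX ^+ m != 0 by rewrite expf_neq0 // lX_neq0.
move: (lX ^+ m) (lX ^+ (k - m)) => v u v0.
by rewrite -mulf_div divff // mulr1 invf_div.
Qed.

Lemma residue0_lXn z : exists m, has_residue (lX ^+ m * z) 0.
Proof.
have [m [k [g [zE _]]]] := laurent_valuation z; exists k.+1.
exists (fpsX F ^+ m.+1 * g); split; last first.
  by rewrite rmorphM rmorphXn /= fps0X expr0n mul0r.
rewrite zE tofracM tofracXn -/lX !exprS.
have : lX ^+ k != 0 by rewrite expf_neq0 // lX_neq0.
move: (lX ^+ m) (lX ^+ k) (tofrac g) => u v w v0.
by rewrite mulrA; apply: (canLR (mulfK v0)); ring.
Qed.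

Lemma residue0_lXn_seq (zs : seq L) : exists m : nat,
  forall z, z \in zs -> has_residue (lX ^+ m * z) 0.
Proof.
elim: zs => [|w zs [m mP]]; first by exists 0.
have [k kP] := residue0_lXn w; exists (m + k)%N => z.
have lXn i : has_residue (lX ^+ i) ('X^i : {poly F})`_0.
  by rewrite -[lX ^+ i]rmorphXn /=; apply: residue_poly.
rewrite inE => /predU1P[->|/mP zP]; rewrite exprD.
  by rewrite -mulrA -(mulr0 ('X^m : {poly F})`_0); apply: residueM.
by rewrite [lX ^+ m * _]mulrC -mulrA -(mulr0 ('X^k : {poly F})`_0); apply: residueM.
Qed.

Variable phi : {rmorphism ratfun F -> L}.
Hypothesis phiE : forall p, phi (tofrac p) = laurent_of_poly p.

(** F(T) is dense in F((T)); the weights [w] express the precision, which may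
    differ from one element of the list to the next. *)
Lemma ratfun_dense z (ws : seq L) : exists p : ratfun F,
  forall w, w \in ws -> has_residue ((phi p - z) * w) 0.
Proof.
have [m [k [g [zE _]]]] := laurent_valuation z.
have [M MP] := residue0_lXn_seq [seq lX ^+ m / lX ^+ k * w | w <- ws].
have [h gh] := fpsXn_trunc M g.
exists (tofrac (fps_trunc M g) * tofrac 'X ^+ m / tofrac 'X ^+ k) => w ws_w.
have -> : (phi (tofrac (fps_trunc M g) * tofrac 'X ^+ m / tofrac 'X ^+ k) - z) * w
  = - tofrac h * (lX ^+ M * (lX ^+ m / lX ^+ k * w)).
  rewrite fmorph_div rmorphM !rmorphXn /= !phiE -/lX zE.
  have -> : laurent_of_poly (fps_trunc M g) = tofrac g - lX ^+ M * tofrac h.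
    by rewrite /lX -[_ ^+ M]tofracXn -tofracM -gh tofracB opprB addrC subrK.
  by ring.
rewrite -(mulr0 (- fps0 h)); apply: residueM; last exact/MP/map_f.
by exists (- h); rewrite !rmorphN.
Qed.

(** Approximating the coefficients of [p] closely enough makes the values at the
    finitely many points of [rs] close.  The induction needs weights, because
    the error on the quotient by X gets multiplied by [r]. *)
Lemma poly_ratfun_dense (p : {poly L}) (rs : seq L) : exists b : {poly ratfun F},
  forall r, r \in rs -> has_residue ((map_poly phi b).[r] - p.[r]) 0.
Proof.
suff approx (w : L -> L) : exists b, forall r, r \in rs ->
    has_residue (((map_poly phi b).[r] - p.[r]) * w r) 0.
  by have [b bP] := approx (fun=> 1); exists b => r /bP; rewrite mulr1.
elim/poly_ind: p w => [|p a IH] w.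
  exists 0 => r _; rewrite map_poly0 !horner0 subrr mul0r.
  by exists 0; rewrite !rmorph0.
have [b bP] := IH (fun r => r * w r).
have [c cP] := ratfun_dense a [seq w r | r <- rs].
exists (b * 'X + c%:P) => r rs_r; rewrite horner_map_MXaddC hornerMXaddC.
have := residueD (bP r rs_r) (cP _ (map_f w rs_r)); rewrite addr0.
congr (has_residue _ 0); move: (map_poly phi b).[r] p.[r] (phi c) (w r).
move: r {rs_r} => r u v d e; ring.
Qed.

(** Weak approximation for the places given by the points [r j]: approximate over
    F(T) the Lagrange basis polynomial of these points. *)
Lemma separating_polys m (r : 'I_m -> L) : injective r -> forall i,
  exists b : {poly ratfun F},
    forall j, has_residue (map_poly phi b).[r j] (j == i)%:R.
Proof.
move=> r_inj i.
have [p pE] := interpolation_basis i r_inj.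
have [b bP] := poly_ratfun_dense p (codom r).
exists b => j; have := residueD (bP _ (codom_f r j)) (residueC (j == i)%:R).
rewrite add0r pE.
have -> : laurent_of_poly ((j == i)%:R)%:P = (j == i)%:R :> L.
  by case: (j == i); rewrite ?rmorph1 ?rmorph0.
by rewrite subrK.
Qed.

End Residue.

(** * Points of the curve over the Laurent series *)

Definition on_curve (R : comNzRingType) (n q : nat) (x t : R) :=
  t ^+ n * x ^+ n * (x ^+ q - x) ^+ n - (x ^+ q - x) ^+ n + t ^+ n = 0.

Lemma on_curve_morph (R S : comNzRingType) (s : {rmorphism R -> S}) n q x t :
  on_curve n q x t -> on_curve n q (s x) (s t).
Proof.
by move/(congr1 s); rewrite rmorph0 !(rmorphD, rmorphN, rmorphM, rmorphXn).
Qed.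

Lemma on_curve_morph_inj (R : fieldType) (S : comNzRingType)
  (s : {rmorphism R -> S}) n q x t :
  on_curve n q (s x) (s t) -> on_curve n q x t.
Proof.
move=> H; apply: (fmorph_inj s); rewrite rmorph0 -[RHS]H.
by rewrite !(rmorphD, rmorphN, rmorphM, rmorphXn).
Qed.

Section LocalEquations.
Variables (n q : nat).

(** The equation of the curve after x = c + t z, divided by t^n: this blow-up
    separates the n points with x = c at t = 0. *)
Definition affine_eq (R : comNzRingType) (c t : R) : {poly R} :=
  let u := (t ^+ q.-1)%:P * 'X^q - 'X in
  (t ^+ n)%:P * (c%:P + t%:P * 'X) ^+ n * u ^+ n - u ^+ n + 1.

(** The equation of the curve after x = z / t, multiplied by t^(n q): the chart at
    the n points where x has a pole. *)
Definition infinity_eq (R : comNzRingType) (t : R) : {poly R} :=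
  let v := 'X^q - (t ^+ q.-1)%:P * 'X in
  'X^n * v ^+ n - v ^+ n + (t ^+ (n * q.+1))%:P.

Lemma map_affine_eq (R S : comNzRingType) (f : {rmorphism R -> S}) c t :
  map_poly f (affine_eq c t) = affine_eq (f c) (f t).
Proof.
rewrite /affine_eq !(rmorphD, rmorphM, rmorphB, rmorphN, rmorphXn, rmorph1) /=.
by rewrite !(map_polyC, map_polyX, rmorphXn).
Qed.

Lemma map_infinity_eq (R S : comNzRingType) (f : {rmorphism R -> S}) t :
  map_poly f (infinity_eq t) = infinity_eq (f t).
Proof.
rewrite /infinity_eq !(rmorphD, rmorphM, rmorphB, rmorphN, rmorphXn) /=.
by rewrite !(map_polyC, map_polyX, rmorphXn).
Qed.

Lemma affine_eq0 (R : comNzRingType) (c : R) : (0 < n)%N -> (1 < q)%N ->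
  affine_eq c 0 = 1 - (- 'X) ^+ n.
Proof.
move=> n0 q1; rewrite /affine_eq !expr0n gtn_eqF // gtn_eqF -?subn1 ?subn_gt0 //.
by rewrite /= polyC0 !mul0r !add0r addrC.
Qed.

Lemma infinity_eq0 (R : comNzRingType) : (0 < n)%N -> (1 < q)%N ->
  infinity_eq (0 : R) = ('X^n - 1) * 'X^(q * n).
Proof.
move=> n0 q1; rewrite /infinity_eq !expr0n muln_eq0 !gtn_eqF -?subn1 ?subn_gt0 //.
by rewrite /= polyC0 mul0r subr0 addr0 -exprM mulrBl mul1r.
Qed.

Lemma horner_affine_eq (R : comNzRingType) (c t z : R) :
  (affine_eq c t).[z] = t ^+ n * (c + t * z) ^+ n * (t ^+ q.-1 * z ^+ q - z) ^+ n
    - (t ^+ q.-1 * z ^+ q - z) ^+ n + 1.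
Proof. by rewrite /affine_eq !hornerE. Qed.

Lemma horner_infinity_eq (R : comNzRingType) (t z : R) :
  (infinity_eq t).[z] = z ^+ n * (z ^+ q - t ^+ q.-1 * z) ^+ n
    - (z ^+ q - t ^+ q.-1 * z) ^+ n + t ^+ (n * q.+1).
Proof. by rewrite /infinity_eq !hornerE. Qed.

End LocalEquations.

Section FiniteField.
Variable F : finFieldType.

(** The multiplicative group of F is cyclic of order divisible by n. *)
Lemma finField_prim_root n : (1 <= n)%N -> #|F| = 1 %[mod n] ->
  exists z : F, n.-primitive_root z.
Proof.
move=> n0 qn; have q1 := card_finRing_gt1 F.
have /hasP[w _ wP] : has (#|F|.-1).-primitive_root [seq x <- enum F | x != 0].
  apply: has_prim_root; first by rewrite -ltnS prednK ?(ltnW q1).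
  - apply/allP => x; rewrite mem_filter => /andP[x0 _].
    rewrite unity_rootE -(inj_eq (mulfI x0)) -exprS prednK ?(ltnW q1) //.
    by rewrite expf_card mulr1.
  - by rewrite filter_uniq // enum_uniq.
  rewrite -rem_filter ?enum_uniq // size_rem ?mem_enum // -cardE.
  exact: leqnn.
exists (w ^+ (#|F|.-1 %/ n)); apply: dvdn_prim_root => //.
by rewrite -subn1 -eqn_mod_dvd ?(ltnW q1) //; apply/eqP.
Qed.

Lemma exprD_card (R : comNzRingType) (c : {rmorphism F -> R}) (x y : R) :
  (x + y) ^+ #|F| = x ^+ #|F| + y ^+ #|F|.
Proof.
have [p p_pr pF] := finPcharP F; apply: exprDn_pchar.
rewrite (eq_pnat _ (pcharf_eq (rmorph_pchar c pF))).
have := card_pprimeChar pF; rewrite -[#|_|]/#|F| => ->.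
by rewrite pnatX pnat_id.
Qed.

Lemma on_curve_affine (R : comNzRingType) (c : {rmorphism F -> R}) n a (z t : R) :
  t ^+ n * (c a + t * z) ^+ n * (t ^+ #|F|.-1 * z ^+ #|F| - z) ^+ n
    - (t ^+ #|F|.-1 * z ^+ #|F| - z) ^+ n + 1 = 0 ->
  on_curve n #|F| (c a + t * z) t.
Proof.
move=> zt; have q0 : (0 < #|F|)%N by rewrite (ltnW (card_finRing_gt1 F)).
rewrite /on_curve (exprD_card c) -rmorphXn expf_card.
have -> : c a + (t * z) ^+ #|F| - (c a + t * z)
    = t * (t ^+ #|F|.-1 * z ^+ #|F| - z).
  rewrite exprMn -{1}(prednK q0) exprS; move: (t ^+ _) (z ^+ _) => u v; ring.
rewrite [(t * _) ^+ n]exprMn -(mulr0 (t ^+ n)) -zt.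
by move: (t ^+ n) (_ ^+ n) (_ ^+ n) => u v w; ring.
Qed.

Lemma on_curve_infinity (E : fieldType) n q (z t : E) : (0 < q)%N -> t != 0 ->
  z ^+ n * (z ^+ q - t ^+ q.-1 * z) ^+ n - (z ^+ q - t ^+ q.-1 * z) ^+ n
    + t ^+ (n * q.+1) = 0 ->
  on_curve n q (z / t) t.
Proof.
move=> q0 t0 zt; set v := z ^+ q - _ in zt.
have yE : (z / t) ^+ q - z / t = v / t ^+ q.
  rewrite expr_div_n /v mulrBl; congr (_ - _).
  rewrite -(prednK q0) exprS /= [t ^+ _ * z]mulrC invfM mulrA.
  by rewrite mulrAC mulfK // expf_neq0.
rewrite /on_curve yE !expr_div_n.
have tn0 : t ^+ n != 0 by rewrite expf_neq0.
have tqn0 : (t ^+ q) ^+ n != 0 by rewrite !expf_neq0.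
apply: (mulIf tqn0); rewrite mul0r -[RHS]zt mulnC exprM exprS.
rewrite [(_ * _) ^+ n]exprMn.
move: (t ^+ n) ((t ^+ q) ^+ n) tn0 tqn0 (z ^+ n) (v ^+ n) => a b a0 b0 c d.
by rewrite [a * _]mulrC divfK // mulrDl mulrBl mulrA !divfK.
Qed.

Variables (n : nat) (zeta : F).
Hypothesis zeta_prim : n.-primitive_root zeta.

Let n0 : (0 < n)%N := prim_order_gt0 zeta_prim.
Let q0 : (0 < #|F|)%N := ltnW (card_finRing_gt1 F).

Let q1 : (0 < #|F|.-1)%N.
Proof. by rewrite -ltnS prednK // card_finRing_gt1. Qed.

Let fpsC : {rmorphism F -> fps F} := @fps_of_poly F \o polyC.

Let zetaXn i : (zeta ^+ i) ^+ n = 1.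
Proof. by rewrite exprAC (prim_expr_order zeta_prim) expr1n. Qed.

Let simple_root i : root ('X^n - 1) (zeta ^+ i) /\
  ~~ root ('X^n - 1)^`() (zeta ^+ i).
Proof.
rewrite !rootE derivB derivXn -polyC1 derivC subr0 !hornerE zetaXn subrr eqxx.
split=> //; rewrite hornerMn hornerXn -mulr_natl mulf_neq0 //.
  exact: prim_root_natf_neq0 zeta_prim.
by rewrite !expf_neq0 // (prim_root_eq0 zeta_prim) gtn_eqF.
Qed.

Lemma affine_point (a : F) (i : nat) : exists z : fps F,
  fps0 z = - zeta ^+ i /\ on_curve n #|F| (fpsC a + fpsX F * z) (fpsX F).
Proof.
have [zn dzn] := simple_root i.
have PE : map_poly (@fps0 F) (affine_eq n #|F| (fpsC a) (fpsX F))
    = - (('X^n - 1) \Po - 'X).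
  rewrite map_affine_eq /= fps0X affine_eq0 ?(card_finRing_gt1 F) //.
  by rewrite comp_polyB comp_Xn_poly comp_polyC opprB.
have [|| z [zP z0]] := 
    @fps_hensel F (affine_eq n #|F| (fpsC a) (fpsX F)) (- zeta ^+ i).
- by rewrite PE rootN root_comp !hornerE opprK.
- rewrite PE derivN rootN deriv_comp derivN derivX mulrN1 rootN root_comp.
  by rewrite !hornerE opprK.
exists z; split=> //; apply: on_curve_affine.
by rewrite -horner_affine_eq.
Qed.

Lemma infinite_point (i : nat) : exists z : fps F,
  fps0 z = zeta ^+ i /\ on_curve n #|F| (tofrac z / lX F) (lX F).
Proof.
have [zn dzn] := simple_root i.
have PE : map_poly (@fps0 F) (infinity_eq n #|F| (fpsX F))
    = ('X^n - 1) * 'X^(#|F| * n).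
  by rewrite map_infinity_eq /= fps0X infinity_eq0 // (card_finRing_gt1 F).
have z0 : zeta ^+ i != 0.
  by rewrite expf_neq0 // (prim_root_eq0 zeta_prim) gtn_eqF.
have [|| z [zP zi]] := @fps_hensel F (infinity_eq n #|F| (fpsX F)) (zeta ^+ i).
- by rewrite PE rootM zn.
- rewrite PE derivM rootE hornerD !hornerM (rootP zn) mul0r addr0.
  by rewrite mulf_neq0 // hornerXn expf_neq0.
exists z; split=> //; apply: on_curve_infinity (lX_neq0 F) _; first exact: q0.
rewrite -horner_infinity_eq -[lX F]/(tofrac (fpsX F)) -map_infinity_eq.
by rewrite horner_map zP rmorph0.
Qed.

(** The value of x at T = 0 and then its coefficient of T, or of 1/T at a pole,
    recover the index, whence injectivity; [None] stands for the point at
    infinity. *)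
Lemma curve_points : exists r : option F * 'I_n -> laurent F,
  injective r /\ forall i, on_curve n #|F| (r i) (lX F).
Proof.
have [z zP] := choice (fun ai : F * nat => affine_point ai.1 ai.2).
have [w wP] := choice infinite_point.
pose r (ai : option F * 'I_n) : laurent F := if ai.1 is Some a
  then tofrac (fpsC a + fpsX F * z (a, val ai.2)) else tofrac (w ai.2) / lX F.
have zeta_inj (i j : 'I_n) : zeta ^+ i = zeta ^+ j -> i = j.
  move/eqP; rewrite (eq_prim_root_expr zeta_prim) !modn_small //.
  by move/eqP/val_inj.
have finite_infinite f (i : 'I_n) : tofrac f <> tofrac (w i) / lX F.
  move/(congr1 (fun u => u * lX F)); rewrite divfK ?lX_neq0 // -tofracM.
  move/eqP; rewrite tofrac_eq.
  move/eqP/(congr1 (@fps0 F))/eqP; rewrite rmorphM /= fps0X mulr0 eq_sym (wP i).1.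
  by rewrite expf_eq0 (prim_root_eq0 zeta_prim) gtn_eqF ?andbF.
have aE a i : fps0 (fpsC a + fpsX F * z (a, i)) = a.
  by rewrite rmorphD rmorphM /= fps0X mul0r addr0 [LHS]coefC.
exists r; split=> [|[[a|] i]].
- move=> [[a|] i] [[b|] j]; rewrite /r /=.
  + move/eqP; rewrite tofrac_eq => /eqP ab.
    have := congr1 (@fps0 F) ab; rewrite !aE => ba; rewrite -{b}ba in ab *.
    move/addrI: ab => /(mulfI (fpsX_neq0 F))/(congr1 (@fps0 F)).
    by rewrite !(zP (a, _)).1 => /oppr_inj/zeta_inj->.
  + by move/finite_infinite.
  + by move/esym/finite_infinite.
  have X0 : (lX F)^-1 != 0 by rewrite invr_eq0 lX_neq0.
  move/(mulIf X0)/eqP; rewrite tofrac_eq => /eqP/(congr1 (@fps0 F)).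
  by rewrite !(wP _).1 => /zeta_inj->.
- exact/on_curve_morph/(zP (a, val i)).2.
- exact: (wP i).2.
Qed.

End FiniteField.

(** * Kummer extensions and simple extensions *)

Section Kummer.
Variables (k E : fieldType) (j : {rmorphism k -> E}) (n : nat) (zeta a : k) (t : E).
Hypotheses (zeta_prim : n.-primitive_root zeta) (a0 : a != 0) (ta : t ^+ n = j a).

Let n0 : (0 < n)%N := prim_order_gt0 zeta_prim.
(** All roots of X^n - a are t times a root of unity of k, so the constant
    coefficient of a factor is, up to a factor in k, a power of t. *)
Lemma Kummer_factor_exp q : q %| 'X^n - a%:P -> exists b, t ^+ (size q).-1 = j b.
Proof.
move=> qp.
have t0 : t != 0.
  by apply: contraNneq a0 => t0; rewrite -(fmorph_eq0 j) -ta t0 expr0n gtn_eqF.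
have split_p : map_poly j ('X^n - a%:P)
    = \prod_(i <- iota 0 n) ('X - (j (zeta ^+ i) * t)%:P).
  rewrite rmorphB /= map_polyXn map_polyC /= -ta.
  rewrite [LHS](@all_roots_prod_XsubC _ _ [seq j (zeta ^+ i) * t | i <- iota 0 n]).
  - by rewrite lead_coefXnsubC // scale1r big_map.
  - by rewrite size_XnsubC // size_map size_iota.
  - apply/allP => _ /mapP[i _ ->] /=; rewrite rootE !hornerE exprMn -rmorphXn.
    by rewrite exprAC (prim_expr_order zeta_prim) expr1n rmorph1 mul1r subrr.
  rewrite uniq_rootsE map_inj_in_uniq ?iota_uniq // => u v.
  rewrite !mem_iota => /andP[_ un] /andP[_ vn] /(mulIf t0)/eqP.
  rewrite (inj_eq (fmorph_inj j)) (eq_prim_root_expr zeta_prim).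
  by rewrite !modn_small // => /eqP.
have := qp; rewrite -(dvdp_map j) split_p => /dvdp_prod_XsubC[m].
set s := mask m _ => qs.
have size_s : (size q).-1 = size s.
  by rewrite -(size_map_poly j) (eqp_size qs) size_prod_XsubC.
move/eqpfP: qs; rewrite lead_coef_prod_XsubC divr1 lead_coef_map => qs.
have q0 : q != 0.
  by apply: contraTneq qp => ->; rewrite dvd0p -size_poly_eq0 size_XnsubC.
have tq : j (q`_0) = j (lead_coef q) * (j ((-1) ^+ size s)
    * (j (\prod_(i <- s) zeta ^+ i) * t ^+ size s)).
  rewrite -coef_map qs coefZ -(big_map (fun i => j (zeta ^+ i) * t) xpredT
    (fun b => 'X - b%:P)) coef0_prod_XsubC size_map big_map rmorphXn rmorphN1.
  by rewrite big_split /= big_const_seq count_predT iter_mulr_1 rmorph_prod.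
exists (q`_0 / (lead_coef q * (-1) ^+ size s * \prod_(i <- s) zeta ^+ i)).
rewrite fmorph_div tq !rmorphM !mulrA size_s mulrAC mulfV ?mul1r //.
rewrite -!rmorphM fmorph_eq0 !mulf_neq0 ?lead_coef_eq0 ?signr_eq0 //.
rewrite prodf_seq_neq0; apply/allP => i _ /=.
by rewrite expf_neq0 // (prim_root_eq0 zeta_prim) gtn_eqF.
Qed.

(** If a factor has degree 0 < d < n, then t^d lies in k, and so does t^g with
    g = gcd(d, n) by Bezout; then a is the (n/g)-th power of t^g. *)
Lemma Kummer_irreducible :
  (forall e h, (1 < e)%N -> (e %| n)%N -> a <> h ^+ e) ->
  irreducible_poly ('X^n - a%:P).
Proof.
move=> not_pow; split=> [|q q1 qp]; first by rewrite size_XnsubC.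
have p0 : 'X^n - a%:P != 0 by rewrite -size_poly_eq0 size_XnsubC.
have [b tb] := Kummer_factor_exp qp; set d := (size q).-1 in tb.
have q0 : q != 0 by apply: contraTneq qp => ->; rewrite dvd0p.
have d0 : (0 < d)%N.
  move: q1; rewrite /d -(prednK (_ : 0 < size q)%N) ?size_poly_gt0 //=.
  by case: (size q).-1.
have : (d <= n)%N.
  by rewrite -ltnS /d prednK ?size_poly_gt0 // -(size_XnsubC a n0) dvdp_leq.
rewrite leq_eqVlt => /predU1P[dn|dn].
  by rewrite -dvdp_size_eqp // size_XnsubC // -dn prednK // size_poly_gt0.
have [u v uv _] := egcdnP n d0.
have g0 : (0 < gcdn d n)%N by rewrite gcdn_gt0 d0.
have gn : (gcdn d n < n)%N by rewrite (leq_ltn_trans _ dn) // dvdn_leq // dvdn_gcdl.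
case: (not_pow (n %/ gcdn d n)%N (b ^+ u / a ^+ v)).
- by rewrite ltn_divRL ?dvdn_gcdr // mul1n.
- by apply/dvdnP; exists (gcdn d n); rewrite mulnC divnK // dvdn_gcdr.
apply: (fmorph_inj j); rewrite -ta rmorphXn fmorph_div !rmorphXn -tb -ta.
have t0 : t != 0.
  by apply: contraNneq a0 => t0; rewrite -(fmorph_eq0 j) -ta t0 expr0n gtn_eqF.
have -> : (t ^+ d) ^+ u / (t ^+ n) ^+ v = t ^+ gcdn d n.
  rewrite -!exprM [(d * u)%N]mulnC uv [(n * v)%N]mulnC exprD mulrC mulKf //.
  by rewrite expf_neq0.
by rewrite -exprM mulnC divnK // dvdn_gcdr.
Qed.

End Kummer.

Lemma power_quotient (K : fieldType) (A B h u v z : K) e :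
  A != 0 -> v != 0 -> z ^+ e = A -> A / B = h ^+ e -> z / h = u / v ->
  u ^+ e = v ^+ e * B.
Proof.
move=> A0 v0 zA hE /(congr1 (fun r => r ^+ e)); rewrite !expr_div_n zA -hE divKf //.
by move=> ->; rewrite mulrC divfK // expf_neq0.
Qed.

Section NotAPower.
Variables (F : fieldType) (n : nat) (zeta : F).
Hypothesis zeta_prim : n.-primitive_root zeta.
Variables (y w : {poly F}).
Hypotheses (y0 : y != 0) (w1 : (1 < size w)%N).

Let n0 : (0 < n)%N := prim_order_gt0 zeta_prim.

Let size_wX m : size (w ^+ m) = ((size w).-1 * m).+1.
Proof.
by rewrite -size_exp prednK // size_poly_gt0 expf_neq0 // -size_poly_gt0 ltnW.
Qed.

Let size_w_gt1 m : (0 < m)%N -> (1 < size (w ^+ m))%N.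
Proof. by move=> m0; rewrite size_wX ltnS muln_gt0 m0 andbT -ltnS prednK // ltnW. Qed.

Lemma one_plus_power_neq0 : 1 + w ^+ n != 0.
Proof.
apply: contraTneq (size_w_gt1 n0) => /eqP; rewrite addrC addr_eq0 => /eqP->.
by rewrite size_polyN size_poly1.
Qed.

(** Each s - w z, for w^e = 1 and z the d-th power, divides 1 and so is constant;
    for e > 1 the difference of two of them is a nonzero multiple of z. *)
Lemma power_difference_neq1 e d (s : {poly F}) : (1 < e)%N -> n = (d * e)%N ->
  s ^+ e - (w ^+ d) ^+ e <> 1.
Proof.
move=> e1 nde s1.
have d0 : (0 < d)%N by move: n0; rewrite nde muln_gt0 => /andP[].
have unit_factor i : size (s - zeta ^+ (d * i) *: w ^+ d) = 1%N.
  apply/eqP; rewrite -dvdp1 -[X in _ %| X]s1.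
  have -> : (w ^+ d) ^+ e = (zeta ^+ (d * i) *: w ^+ d) ^+ e.
    rewrite exprZn -[(zeta ^+ _) ^+ e]exprM mulnAC -nde exprM.
    by rewrite (prim_expr_order zeta_prim) expr1n scale1r.
  by rewrite subrXX dvdp_mulr.
have : (size ((s - zeta ^+ (d * 0) *: w ^+ d)
    - (s - zeta ^+ (d * 1) *: w ^+ d))%R <= 1)%N.
  by rewrite (leq_trans (size_polyD _ _)) // size_polyN geq_max !unit_factor.
rewrite muln0 muln1 expr0 opprB addrC addrA subrK -scalerBl size_scale.
  by rewrite leqNgt size_w_gt1.
rewrite subr_eq0 -[X in _ != X](expr0 zeta) (eq_prim_root_expr zeta_prim).
by rewrite mod0n modn_small -?lt0n // nde ltn_Pmulr.
Qed.

(** An e-th root of 1 + w^n in F(x) lies in F[x], because v^e | u^e forces v | u. *)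
Lemma not_power e (h : ratfun F) : (1 < e)%N -> (e %| n)%N ->
  tofrac (y ^+ n) / tofrac (1 + w ^+ n) <> h ^+ e.
Proof.
move=> e1 /dvdnP[d nde] hE.
have e0 := ltnW e1.
have yn0 : tofrac (y ^+ n) != 0 :> ratfun F by rewrite tofrac_eq0 expf_neq0.
have u0 : tofrac (1 + w ^+ n) != 0 :> ratfun F.
  by rewrite tofrac_eq0 one_plus_power_neq0.
have [u [v [v0 sE]]] := fraction_ratio (tofrac (y ^+ d) / h).
have vF0 : tofrac v != 0 :> ratfun F by rewrite tofrac_eq0.
have : u ^+ e = v ^+ e * (1 + w ^+ n).
  apply/eqP; rewrite -(@tofrac_eq {poly F}) tofracM !tofracXn; apply/eqP.
  by apply: (power_quotient yn0 vF0 _ hE sE); rewrite -tofracXn -exprM -nde.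
move=> uv; have /dvdpP[s us] : v %| u by rewrite -(dvdp_pexp2r _ _ e0) uv dvdp_mulr.
apply: (power_difference_neq1 e1 nde (s := s)).
have ve0 : v ^+ e != 0 by rewrite expf_neq0.
apply: (mulfI ve0); rewrite mulrBr [v ^+ e * s ^+ e]mulrC -exprMn -us uv.
by rewrite -exprM -nde mulrDr addrK.
Qed.
End NotAPower.

Section Transcendence.
Variables (F E : fieldType) (c : {rmorphism F -> E}).

Lemma algebraic_exp x m : algebraicOver c x -> algebraicOver c (x ^+ m).
Proof.
by move=> cx; elim: m => [|m IH]; [exact: algebraic1 | rewrite exprS; apply: algebraic_mul].
Qed.

Lemma algebraic_expI x m : (0 < m)%N -> algebraicOver c (x ^+ m) -> algebraicOver c x.
Proof.
move=> m0 cx; apply/integral_algebraic.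
apply: (@integral_root_monic _ _ _ _ ('X^m - (x ^+ m)%:P)).
- exact: monicXnsubC.
- by rewrite rootE !hornerE subrr.
apply/integral_poly => i; apply/integral_algebraic; rewrite coefB coefXn coefC.
apply: algebraic_sub; last by case: (i == 0)%N; [exact: cx | exact: algebraic0].
by case: (i == m); [exact: algebraic1 | exact: algebraic0].
Qed.

Lemma curve_solve n q (x t : E) : on_curve n q x t -> (0 < n)%N ->
  1 + (x * (x ^+ q - x)) ^+ n != 0 /\
  t ^+ n = (x ^+ q - x) ^+ n / (1 + (x * (x ^+ q - x)) ^+ n).
Proof.
rewrite /on_curve; set y := x ^+ q - x => xt n0.
have ty : t ^+ n * (1 + (x * y) ^+ n) = y ^+ n.
  apply/eqP; rewrite -subr_eq0 -[X in _ == X]xt; apply/eqP.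
  by rewrite exprMn; move: (t ^+ n) (x ^+ n) (y ^+ n) => a b d; ring.
have m0 : 1 + (x * y) ^+ n != 0.
  apply: contra_eq_neq ty => m0; rewrite m0 mulr0 eq_sym.
  apply: contraNneq (oner_neq0 E) => /eqP; rewrite expf_eq0 n0 /= => /eqP y0.
  by rewrite -m0 y0 mulr0 expr0n gtn_eqF // addr0.
by split=> //; apply: (canRL (mulfK m0)).
Qed.

(** Solving the equation for t^n shows that t is algebraic over F(x). *)
Lemma curve_transcendental n q (x t : E) : (0 < n)%N -> on_curve n q x t ->
  transcendental c t -> transcendental c x.
Proof.
move=> n0 /curve_solve/(_ n0)[_ tE] trt cx; apply: trt.
apply: (algebraic_expI n0); rewrite tE.
have cy : algebraicOver c (x ^+ q - x) by apply: algebraic_sub => //; apply: algebraic_exp.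
apply: algebraic_div; first exact: algebraic_exp.
by apply: algebraic_add; [exact: algebraic1 | apply: algebraic_exp; apply: algebraic_mul].
Qed.

End Transcendence.

Section SimpleExtension.
Variables (k : fieldType) (h : {poly k}) (hI : monic_irreducible_poly h).
Local Notation K := {poly %/ h with hI}.

Section Evaluation.
Variables (E : fieldType) (s : {rmorphism k -> E}) (t : E).
Hypothesis ht : root (map_poly s h) t.

Let ev (z : K) := (map_poly s (z : {poly %/ h})).[t].

Let ev_in_qpoly p : ev (in_qpoly h p) = (map_poly s p).[t].
Proof.
rewrite /ev /= (mk_monicE hI) [in RHS](Pdiv.RingMonic.rdivp_eq hI.2 p).
by rewrite rmorphD rmorphM hornerD hornerM (rootP ht) mulr0 add0r.
Qed.

Let ev_additive : zmod_morphism ev.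
Proof. by move=> p q; rewrite /ev -hornerN -hornerD -rmorphB. Qed.

Let ev_multiplicative : monoid_morphism ev.
Proof.
split=> [|p q].
  have -> : ev 1 = (map_poly s 1%:P).[t] by [].
  by rewrite map_polyC hornerC /= rmorph1.
by rewrite -[ev p * ev q]hornerM -rmorphM -ev_in_qpoly; congr ev.
Qed.

Lemma quotient_evaluation : exists sigma : {rmorphism K -> E},
  forall p, sigma (in_qpoly h p) = (map_poly s p).[t].
Proof.
pose A := GRing.isZmodMorphism.Build _ _ ev ev_additive.
pose B := GRing.isMonoidMorphism.Build _ _ ev ev_multiplicative.
pose S : {rmorphism K -> E} := HB.pack ev A B.
by exists S.
Qed.

End Evaluation.

Let quotC (b : k) : K := in_qpoly h b%:P.

Let quotC_additive : zmod_morphism quotC.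
Proof. by move=> b d; rewrite /quotC raddfB [LHS]raddfB. Qed.

Let quotC_multiplicative : monoid_morphism quotC.
Proof. by split=> [|b d]; rewrite /quotC ?polyCM; [exact: rmorph1 | exact: rmorphM]. Qed.

(** The adjunction of a root of [h], described by its universal property.  The
    quotient ring is hidden behind the existential, so that no later
    computation unfolds it. *)
Lemma simple_extension :
  exists (L : fieldType) (e : {rmorphism k -> L}) (theta : L),
  [/\ root (map_poly e h) theta,
      forall z, exists2 p : {poly k}, (size p < size h)%N & z = (map_poly e p).[theta],
      forall p : {poly k}, root (map_poly e p) theta -> h %| p
    & forall (E : fieldType) (s : {rmorphism k -> E}) (t : E),
        root (map_poly s h) t -> exists sigma : {rmorphism L -> E},
          (forall b, sigma (e b) = s b) /\ sigma theta = t].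
Proof.
pose A := GRing.isZmodMorphism.Build _ _ quotC quotC_additive.
pose B := GRing.isMonoidMorphism.Build _ _ quotC quotC_multiplicative.
pose e : {rmorphism k -> K} := HB.pack quotC A B.
pose theta : K := in_qpoly h 'X.
have eval p : (map_poly e p).[theta] = in_qpoly h p.
  elim/poly_ind: p => [|p b IH]; first by rewrite map_poly0 horner0 [RHS]raddf0.
  by rewrite horner_map_MXaddC IH [RHS]raddfD /= in_qpolyM.
have dvd p : root (map_poly e p) theta -> h %| p.
  rewrite rootE eval => /eqP/(congr1 (@polyn _ _)) /=; rewrite (mk_monicE hI) => p0.
  by rewrite (Pdiv.RingMonic.rdivp_eq hI.2 p) p0 addr0 dvdp_mulIr.
exists K, e, theta; split=> //.
- apply/rootP; rewrite eval; apply: val_inj; rewrite /= (mk_monicE hI).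
  exact: Pdiv.RingMonic.rmodpp hI.2.
- move=> z; exists (z : {poly %/ h}); first by rewrite -{2}(mk_monicE hI) size_mk_monic.
  rewrite eval; apply: val_inj; exact: esym (in_qpoly_small (size_mk_monic z)).
move=> E s t ht; have [sigma sigmaE] := quotient_evaluation ht.
exists sigma; split=> [b|]; first by rewrite [LHS]sigmaE map_polyC hornerC.
by rewrite sigmaE map_polyX hornerX.
Qed.

End SimpleExtension.

(** * The function field of the curve *)

Lemma laurent_of_poly_inj (F : fieldType) : injective (@laurent_of_poly F).
Proof.
move=> p r /eqP; rewrite tofrac_eq => /eqP/(congr1 (@fpscoef F)) pr.
by apply/polyP => i; have := congr1 (fun f => f i) pr.
Qed.


Section CurveField.
Variables (F : finFieldType) (n : nat) (zeta : F).
Hypothesis zeta_prim : n.-primitive_root zeta.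

Let n0 : (0 < n)%N := prim_order_gt0 zeta_prim.
Local Notation q := #|F|.
Let q1 : (1 < q)%N := card_finRing_gt1 F.

Let y : {poly F} := 'X^q - 'X.
Let w : {poly F} := 'X * y.
Let a : ratfun F := tofrac (y ^+ n) / tofrac (1 + w ^+ n).

Let size_y : size y = q.+1.
Proof. by rewrite size_polyDl size_polyXn // size_polyN size_polyX. Qed.

Let y0 : y != 0. Proof. by rewrite -size_poly_eq0 size_y. Qed.

Let w1 : (1 < size w)%N.
Proof. by rewrite /w mulrC size_mulX // size_y. Qed.

Let a0 : a != 0.
Proof.
by rewrite mulf_neq0 ?invr_eq0 ?tofrac_eq0 ?expf_neq0 // (one_plus_power_neq0 zeta_prim).
Qed.

Let aE (E : fieldType) (x t : E) (s : {rmorphism ratfun F -> E}) :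
  s (tofrac 'X) = x -> on_curve n q x t -> t ^+ n = s a.
Proof.
move=> sX /curve_solve/(_ n0)[_ ->].
pose s' : {rmorphism {poly F} -> E} := s \o @tofrac {poly F}.
have s'X : s' 'X = x by [].
have -> : s a = s' (y ^+ n) / s' (1 + w ^+ n) by rewrite fmorph_div.
clearbody s'; rewrite /w /y !(rmorphXn, rmorphD, rmorphM, rmorphN, rmorph1) .
by rewrite s'X.
Qed.

Lemma transcendental_lX :
  transcendental (@laurent_of_poly F \o polyC) (lX F).
Proof.
case=> p p0 /rootP; rewrite map_poly_comp horner_map /=.
rewrite -[_.['X]]/(p \Po 'X) comp_polyXr => pl0.
by case/eqP: p0; apply: (@laurent_of_poly_inj F); rewrite pl0 rmorph0.
Qed.

Let h := 'X^n - a%:P.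

(** Kummer theory asks for an n-th root of a in some extension of F(x); a point
    of the curve over F((T)) supplies one. *)
Lemma curve_irreducible : monic_irreducible_poly h.
Proof.
split; last exact: monicXnsubC.
have [r [_ rP]] := curve_points zeta_prim.
pose x := r (None, Ordinal n0).
have xc : on_curve n q x (lX F) := rP _.
have [s [sX sc]] := transcendental_ext (curve_transcendental n0 xc transcendental_lX).
have prim : n.-primitive_root (tofrac zeta%:P : ratfun F).
  have : n.-primitive_root ((@tofrac {poly F} \o polyC) zeta) by rewrite fmorph_primitive_root.
  by [].
apply: (Kummer_irreducible prim a0 (aE sX xc)) => e b e1 en.
exact: (not_power zeta_prim y0 w1).
Qed.

(** F(x, t), as a vector space over F(x) with basis 1, t, ..., t^(n-1) and by its
    universal property among the fields that contain a point of the curve. *)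
Lemma curve_function_field :
  exists (K : fieldType) (e : {rmorphism ratfun F -> K}) (t0 : K),
  [/\ on_curve n q (e (tofrac 'X)) t0,
      forall z, exists2 p : {poly ratfun F}, (size p <= n)%N & z = (map_poly e p).[t0],
      forall p : {poly ratfun F}, (size p <= n)%N -> (map_poly e p).[t0] = 0 -> p = 0
    & forall (E : fieldType) (c : {rmorphism F -> E}) (x t : E),
        on_curve n q x t -> transcendental c t ->
        exists sigma : {rmorphism K -> E}, [/\ sigma (e (tofrac 'X)) = x,
          sigma t0 = t & forall b, sigma (e (tofrac b%:P)) = c b] ].
Proof.
have [K [e [t0 [ht0 gen dvd ext]]]] := simple_extension curve_irreducible.
have size_h : size h = n.+1 by rewrite size_XnsubC.
have extP (E : fieldType) (c : {rmorphism F -> E}) (x t : E) :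
    on_curve n q x t -> transcendental c t ->
    exists sigma : {rmorphism K -> E}, [/\ sigma (e (tofrac 'X)) = x,
      sigma t0 = t & forall b, sigma (e (tofrac b%:P)) = c b].
  move=> xc trt.
  have [s [sX sc]] := transcendental_ext (curve_transcendental n0 xc trt).
  have [|sigma [sigmaE sigmat]] := ext E s t.
    rewrite rootE rmorphB /= map_polyXn map_polyC hornerD hornerN hornerXn hornerC.
    by rewrite (aE sX xc) subrr.
  by exists sigma; split=> // [|b]; rewrite sigmaE ?sX ?sc.
have [r [_ rP]] := curve_points zeta_prim.
have [sigma [sX st sc]] := extP _ _ _ _ (rP (None, Ordinal n0)) transcendental_lX.
exists K, e, t0; split=> //.
- apply: (@on_curve_morph_inj _ _ sigma); rewrite sX st; exact: rP.
- by move=> z; have [p] := gen z; rewrite size_h; exists p.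
move=> p pn /rootP/dvd hp; apply/eqP; apply: contraTT pn => p0.
by rewrite -ltnNge -size_h dvdp_leq.
Qed.

End CurveField.

(** * Functions with many zeros at rational places *)

Lemma pigeonhole_fiber (I J : finType) (f : I -> J) d : (d * #|J| < #|I|)%N ->
  exists o, exists2 s : 'I_d.+1 -> I, injective s & forall i, f (s i) = o.
Proof.
move=> dI; have [/existsP[o oP]|] := boolP [exists o, (d < #|[pred i | f i == o]|)%N].
  exists o; exists (fun i => enum_val (widen_ord oP i)).
    by move=> i j /enum_val_inj/(congr1 val) /= /val_inj.
  by move=> i; have := enum_valP (widen_ord oP i); rewrite inE => /eqP.
rewrite negb_exists => /forallP small; move: dI; rewrite ltnNge.
have -> : #|I| = (\sum_(o : J) #|[pred i | f i == o]|)%N.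
  rewrite -sum1_card (partition_big f xpredT) //=.
  by apply: eq_bigr => o _; rewrite -sum1_card; apply: eq_bigl => i; rewrite inE.
rewrite mulnC -sum_nat_const leq_sum // => o _.
by rewrite leqNgt small.
Qed.

Lemma common_denominator (R : idomainType) m (v : 'I_m -> {fraction R}) :
  exists D, exists2 w : 'I_m -> R, D != 0 & forall i, v i * tofrac D = tofrac (w i).
Proof.
have ratio i : exists ab : R * R, ab.2 != 0 /\ v i = tofrac ab.1 / tofrac ab.2.
  by have [a [b ?]] := fraction_ratio (v i); exists (a, b).
have [ab abP] := choice ratio.
exists (\prod_i (ab i).2), (fun i => (ab i).1 * \prod_(k | k != i) (ab k).2).
  by apply/prodf_neq0 => i _; have [] := abP i.
move=> i; have [b0 ->] := abP i.
rewrite (bigD1 i) //= !tofracM mulrA divfK //.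
by rewrite tofrac_eq0.
Qed.

Section Independence.
Variables (F : fieldType) (K : fieldType) (c : {rmorphism F -> K}) (m : nat).
Variables (sigma : 'I_m -> {rmorphism K -> laurent F}) (psi : K) (beta : 'I_m -> K).
Hypothesis sigmaC : forall i b, sigma i (c b) = laurent_of_poly b%:P.
Hypothesis psi0 : psi != 0.
Hypothesis sigma_psi : forall i, has_residue (sigma i psi) 0.
Hypothesis sigma_beta : forall i j, has_residue (sigma i (beta j)) (i == j)%:R.

Lemma residue_eval i (p : {poly F}) : has_residue (sigma i (map_poly c p).[psi]) p`_0.
Proof.
have -> : sigma i (map_poly c p).[psi]
    = (map_poly (@laurent_of_poly F \o polyC) p).[sigma i psi].
  rewrite -horner_map -map_poly_comp; congr _.[_].
  by apply: eq_map_poly => b; exact: sigmaC.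
by rewrite -horner_coef0; apply: residue_horner.
Qed.

(** Reducing a relation at the i-th place kills all terms but the i-th and turns
    psi into 0, so the constant coefficient of each w_i vanishes.  All the
    coefficients w_j are then divisible by psi, and the relation divided by psi
    has smaller degree. *)
Lemma poly_independent (w : 'I_m -> {poly F}) :
  \sum_j (map_poly c (w j)).[psi] * beta j = 0 -> forall j, w j = 0.
Proof.
have [N] : exists N, forall j, (size (w j) <= N)%N.
  by exists (\max_j size (w j))%N => j; apply: leq_bigmax.
elim: N w => [|N IH] w wN w0.
  by move=> j; apply/eqP; rewrite -size_poly_leq0.
have wi0 i : (w i)`_0 = 0.
  have wi : has_residue (sigma i (\sum_j (map_poly c (w j)).[psi] * beta j)) (w i)`_0.
    rewrite rmorph_sum /=.
    have -> : (w i)`_0 = \sum_j (w j)`_0 * (i == j)%:R.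
      rewrite (bigD1 i) //= eqxx mulr1 big1 ?addr0 // => j ji.
      by rewrite eq_sym (negPf ji) mulr0.
    by apply: residue_sum => j; rewrite rmorphM; apply: residueM (residue_eval _ _) _.
  apply: residue_uniq wi _; rewrite w0 rmorph0; exists 0; by rewrite !rmorph0.
have wX j : w j = drop_poly 1 (w j) * 'X.
  rewrite -[LHS](poly_take_drop 1) [take_poly 1 _](_ : _ = 0) ?add0r ?expr1 //.
  by apply/polyP => -[|i]; rewrite coef_take_poly coef0 //= wi0.
have w'0 := IH (fun j => drop_poly 1 (w j)).
move=> j; rewrite wX w'0 ?mul0r // => [i|]; first by rewrite size_drop_poly leq_subLR.
apply: (mulfI psi0); rewrite mulr0 mulr_sumr -[RHS]w0; apply: eq_bigr => i _.
by rewrite [in RHS]wX rmorphM /= map_polyX hornerMX mulrA [psi * _]mulrC.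
Qed.

Lemma ratfun_independent (J : {rmorphism ratfun F -> K}) (v : 'I_m -> ratfun F) :
  J (tofrac 'X) = psi -> (forall b, J (tofrac b%:P) = c b) ->
  \sum_j J (v j) * beta j = 0 -> forall j, v j = 0.
Proof.
move=> JX Jc v0; have [D [w D0 vw]] := common_denominator v.
have DF0 : tofrac D != 0 :> ratfun F by rewrite tofrac_eq0.
have w0 : forall j, w j = 0.
  apply: poly_independent; rewrite -[RHS](mul0r (J (tofrac D))).
  rewrite -[X in X * J _]v0 mulr_suml.
  apply: eq_bigr => j _; rewrite -JX -(ratfun_morph_tofrac _ Jc) -vw rmorphM.
  by rewrite mulrAC.
by move=> j; apply: (mulIf DF0); rewrite vw w0 mul0r rmorph0.
Qed.

End Independence.

Section ProjectiveReduction.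
Variables (F : finFieldType) (K : fieldType) (c : {rmorphism F -> K}).
Variables (I : finType) (sigma : I -> {rmorphism K -> laurent F}).
Hypothesis sigmaC : forall i b, sigma i (c b) = laurent_of_poly b%:P.

(** The coordinate that vanishes at the chosen places is psi - b or 1 / psi; either
    one generates a field containing F(psi). *)
Lemma many_zeros (psi : K) d : (d * #|F|.+1 < #|I|)%N -> transcendental c psi ->
  exists (J : {rmorphism ratfun F -> K}), exists2 s : 'I_d.+1 -> I, injective s &
    [/\ forall b, J (tofrac b%:P) = c b, exists z, J z = psi
      & forall i, has_residue (sigma (s i) (J (tofrac 'X))) 0].
Proof.
move=> dI trpsi.
have red i : exists o : option F, if o is Some b then has_residue (sigma i psi) b
    else has_residue (sigma i psi^-1) 0.
  case: (residue_or_pole (sigma i psi)) => [[b ?]|[_ ?]]; first by exists (Some b).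
  by exists None; rewrite fmorphV.
have [f fP] := choice red.
have := @pigeonhole_fiber I _ f d; rewrite card_option => /(_ dI)[o [s s_inj so]].
case: o so => [b|] so.
  have tr : transcendental c (psi - c b).
    move=> alg; apply: trpsi; rewrite -(subrK (c b) psi).
    by apply: algebraic_add alg (algebraic_id _ _).
  have [J [JX Jc]] := transcendental_ext tr.
  exists J, s => //; split=> // [|i].
    by exists (tofrac 'X + tofrac b%:P); rewrite rmorphD /= JX Jc subrK.
  rewrite JX rmorphB sigmaC -(subrr b).
  by have := fP (s i); rewrite so => /residueB; apply; apply: residueC.
have tr : transcendental c psi^-1.
  by move=> alg; apply: trpsi; rewrite -[psi]invrK; apply: algebraic_inv.
have [J [JX Jc]] := transcendental_ext tr.
exists J, s => //; split=> // [|i].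
  by exists (tofrac 'X)^-1; rewrite fmorphV JX invrK.
by have := fP (s i); rewrite so JX.
Qed.

End ProjectiveReduction.

(** * The polynomial of the curve *)

Section CurvePolynomial.
Variables n q : nat.

Definition curve_poly (R : comNzRingType) (t : R) : {poly R} :=
  (t ^+ n)%:P * 'X^n * ('X^q - 'X) ^+ n - ('X^q - 'X) ^+ n + (t ^+ n)%:P.

Lemma map_curve_poly (R S : comNzRingType) (f : {rmorphism R -> S}) t :
  map_poly f (curve_poly t) = curve_poly (f t).
Proof.
rewrite /curve_poly !(rmorphD, rmorphN, rmorphM, rmorphXn) /=.
by rewrite !(map_polyC, map_polyX).
Qed.

Lemma root_curve_poly (R : comNzRingType) (x t : R) :
  root (curve_poly t) x <-> on_curve n q x t.
Proof.
have E : (curve_poly t).[x] =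
  t ^+ n * x ^+ n * (x ^+ q - x) ^+ n - (x ^+ q - x) ^+ n + t ^+ n.
  by rewrite /curve_poly !hornerE.
by split=> [/rootP|H]; last apply/rootP; rewrite E.
Qed.

Hypotheses (n0 : (0 < n)%N) (q1 : (1 < q)%N).

Lemma size_XqsubXn (R : idomainType) : size (('X^q - 'X : {poly R}) ^+ n) = (n * q).+1.
Proof.
have sz : size ('X^q - 'X : {poly R}) = q.+1.
  by rewrite size_polyDl size_polyXn // size_polyN size_polyX.
have y0 : ('X^q - 'X : {poly R}) != 0 by rewrite -size_poly_eq0 sz.
rewrite -[LHS]prednK ?size_exp ?sz ?[(n * q)%N]mulnC //.
by rewrite size_poly_gt0 expf_neq0.
Qed.

Lemma lead_coef_XqsubXn (R : idomainType) :
  lead_coef (('X^q - 'X : {poly R}) ^+ n) = 1.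
Proof.
rewrite lead_coef_exp lead_coefDl ?lead_coefXn ?expr1n //.
by rewrite size_polyXn size_polyN size_polyX.
Qed.

Let lead_term (R : idomainType) (t : R) : {poly R} :=
  (t ^+ n)%:P * 'X^n * ('X^q - 'X) ^+ n.

Let size_lead_term (R : idomainType) (t : R) : t != 0 ->
  size (lead_term t) = (n * q.+1).+1.
Proof.
move=> t0; rewrite /lead_term -mulrA size_Cmul ?expf_neq0 // mulrC.
rewrite size_mulXn; last by rewrite -size_poly_eq0 size_XqsubXn.
by rewrite size_XqsubXn mulnS addnS.
Qed.

Lemma curve_poly_size_lead (R : idomainType) (t : R) : t != 0 ->
  size (curve_poly t) = (n * q.+1).+1 /\ lead_coef (curve_poly t) = t ^+ n.
Proof.
move=> t0; have szT := size_lead_term t0.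
have lt : (size (- ('X^q - 'X) ^+ n + (t ^+ n)%:P)%R < size (lead_term t))%N.
  rewrite szT ltnS (leq_trans (size_polyD _ _)) // geq_max size_polyN size_XqsubXn.
  rewrite (leq_trans (size_polyC_leq1 _)) ?muln_gt0 ?n0 // andbT.
  by rewrite ltn_mul2l n0 ltnS leqnn.
rewrite /curve_poly -addrA size_polyDl // lead_coefDl //; split=> //.
by rewrite !lead_coefM lead_coefC lead_coefXn lead_coef_XqsubXn !mulr1.
Qed.

Lemma curve_poly_neq0 (R : idomainType) (t : R) : t != 0 -> curve_poly t != 0.
Proof.
by move=> /curve_poly_size_lead[sz _]; rewrite -size_poly_eq0 sz.
Qed.

Section Bivariate.
Variable F : fieldType.
Let f : {poly {poly F}} := curve_poly 'X.

Let coef_f i : exists a b : F, f`_i = 'X^n * a%:P - b%:P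
  /\ b = (('X^q - 'X : {poly F}) ^+ n)`_i.
Proof.
pose B : {poly F} := ('X^q - 'X) ^+ n; pose A := 'X^n * B + 1.
exists A`_i, B`_i; split=> //.
have -> : f = ('X^n)%:P * map_poly polyC A - map_poly polyC B.
  rewrite /f /curve_poly /A rmorphD rmorphM rmorph1 /= map_polyXn mulrDr mulr1.
  have -> : map_poly polyC B = ('X^q - 'X) ^+ n.
    by rewrite rmorphXn rmorphB /= map_polyXn map_polyX.
  by rewrite mulrA addrAC.
by rewrite coefB coefCM !coef_map.
Qed.

Lemma sizeY_curve_poly : sizeY f = n.+1.
Proof.
have [_ lf] := curve_poly_size_lead (negbT (polyX_eq0 F)).
apply/eqP; rewrite eqn_leq; apply/andP; split; last first.
  by have := max_size_lead_coefXY f; rewrite lf size_polyXn.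
apply/bigmax_leqP => i _; have [a [b [-> _]]] := coef_f i.
rewrite (leq_trans (size_polyD _ _)) // geq_max size_polyN.
rewrite (leq_trans (size_polyC_leq1 _)) // andbT mulrC mul_polyC.
by rewrite (leq_trans (size_scale_leq _ _)) // size_polyXn.
Qed.

(** The leading coefficient is T^n, while the coefficient of x^(n q) is congruent
    to -1 modulo T. *)
Lemma curve_poly_primitive (d : {poly F}) : (forall i, d %| f`_i) -> d %= 1.
Proof.
move=> df; rewrite -size_poly_eq1 -dvdp1.
have [sz lf] := curve_poly_size_lead (negbT (polyX_eq0 F)).
have dX : d %| 'X^n by rewrite -lf; apply: df.
have [a [b [fE bE]]] := coef_f (n * q).
have b1 : b = 1 by rewrite bE -(lead_coef_XqsubXn F) lead_coefE size_XqsubXn.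
have := df (n * q)%N; rewrite fE b1 => dfX.
by rewrite -(dvdp_subr _ (dvdp_mulr a%:P dX)).
Qed.

End Bivariate.
End CurvePolynomial.

(** * Minimal polynomial, height and gonality *)

Section GeneratedSubfield.
Variables (F : finFieldType) (Omega : closedFieldType).
Variable iota : {rmorphism ratfun F -> Omega}.
Implicit Types (S : set Omega) (z : Omega).
Local Notation gen := (subfield_gen iota).

Lemma subfield_gen_range (K : fieldType) (j : {rmorphism K -> Omega}) S :
  (forall b, exists x, j x = const_embed iota b) ->
  (forall s, S s -> exists x, j x = s) ->
  forall z, gen S z -> exists x, j x = z.
Proof.
move=> jC jS z Sz; have [] : range j z; last by move=> x _ <-; exists x.
apply: Sz; split.
  split=> [|u v|u v]; rewrite !in_setE /=; first by exists 1; rewrite ?rmorph1.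
  - by move=> [x _ <-] [x' _ <-]; exists (x - x'); rewrite ?rmorphB.
  - by move=> [x _ <-] [x' _ <-]; exists (x / x'); rewrite ?fmorph_div.
move=> _ [[b _ <-]|/jS[x <-]]; last by exists x.
by have [x <-] := jC b; exists x.
Qed.

Lemma subfield_gen_closed S : divring_closed [in gen S].
Proof.
split=> [|u v|u v]; rewrite !in_setE.
- by move=> A [[A1 _ _] _]; rewrite in_setE in A1.
- move=> uS vS A AS; have [[_ AB _] _] := AS.
  by have := AB u v; rewrite !in_setE; apply; [exact: uS | exact: vS].
move=> uS vS A AS; have [[_ _ AV] _] := AS.
by have := AV u v; rewrite !in_setE; apply; [exact: uS | exact: vS].
Qed.

Lemma subfield_genB S u v : gen S u -> gen S v -> gen S (u - v).
Proof. by have [_ B _] := subfield_gen_closed S; have := B u v; rewrite !in_setE. Qed.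

Lemma subfield_gen_div S u v : gen S u -> gen S v -> gen S (u / v).
Proof. by have [_ _ V] := subfield_gen_closed S; have := V u v; rewrite !in_setE. Qed.

Lemma subfield_gen1 S : gen S 1.
Proof. by have [H _ _] := subfield_gen_closed S; rewrite in_setE in H. Qed.

Lemma subfield_gen0 S : gen S 0.
Proof. by rewrite -(subrr 1); apply: subfield_genB; apply: subfield_gen1. Qed.

Lemma subfield_genD S u v : gen S u -> gen S v -> gen S (u + v).
Proof.
move=> uS vS; rewrite -[v]opprK -[- v]sub0r; do 2!apply: subfield_genB => //.
exact: subfield_gen0.
Qed.

Lemma subfield_genM S u v : gen S u -> gen S v -> gen S (u * v).
Proof.
move=> uS vS; rewrite -[v]invrK -[v^-1]div1r; do 2!apply: subfield_gen_div => //.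
exact: subfield_gen1.
Qed.

Lemma subfield_gen_incl S z : S z -> gen S z.
Proof. by move=> Sz A [_ AS]; apply: AS; right. Qed.

Lemma subfield_gen_const S b : gen S (const_embed iota b).
Proof. by move=> A [_ AS]; apply: AS; left; exists b. Qed.

Lemma subfield_gen_horner S (k : fieldType) (s : {rmorphism k -> Omega}) p z :
  (forall b, gen S (s b)) -> gen S z -> gen S (map_poly s p).[z].
Proof.
move=> sS zS; elim/poly_ind: p => [|p b IH].
  by rewrite map_poly0 horner0; apply: subfield_gen0.
rewrite horner_map_MXaddC; exact: subfield_genD (subfield_genM IH zS) (sS b).
Qed.

Lemma subfield_gen_ratfun S (s : {rmorphism ratfun F -> Omega}) :
  (forall b, s (tofrac b%:P) = const_embed iota b) ->
  gen S (s (tofrac 'X)) -> forall w, gen S (s w).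
Proof.
move=> sC sX w; have [a [b [_ ->]]] := fraction_ratio w; rewrite fmorph_div.
pose c : {rmorphism F -> Omega} := iota \o (@tofrac {poly F} \o polyC).
by apply: subfield_gen_div; rewrite (@ratfun_morph_tofrac _ _ s c) //;
   apply: subfield_gen_horner => // d; apply: subfield_gen_const.
Qed.

End GeneratedSubfield.

(** The field K, its embedding j into Omega and its embeddings sigma i into
    F((T)), one for each point of the curve with t = T, are variables with
    the properties that the existence statements [curve_function_field] and
    [curve_points] give them. *)
Section Main.
Variables (n : nat) (F : finFieldType) (zeta : F).
Hypothesis zeta_prim : n.-primitive_root zeta.
Variables (Omega : closedFieldType) (iota : {rmorphism ratfun F -> Omega}).
Variable alpha : Omega.
Local Notation q := #|F|.
Local Notation T := (iota (tofrac 'X)).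
Hypothesis alpha_curve : on_curve n q alpha T.

Let n0 : (0 < n)%N := prim_order_gt0 zeta_prim.
Let q1 : (1 < q)%N := card_finRing_gt1 F.

Variables (K : fieldType) (e : {rmorphism ratfun F -> K}) (t0 : K).
Let x0 := e (tofrac 'X).
Hypothesis K_gen : forall z, exists2 p : {poly ratfun F},
  (size p <= n)%N & z = (map_poly e p).[t0].
Hypothesis K_free : forall p : {poly ratfun F},
  (size p <= n)%N -> (map_poly e p).[t0] = 0 -> p = 0.
Let cK : {rmorphism F -> K} := e \o (@tofrac {poly F} \o polyC).
Variable j : {rmorphism K -> Omega}.
Hypotheses (jx : j x0 = alpha) (jt : j t0 = T).
Hypothesis jC : forall b, j (cK b) = const_embed iota b.
Variables (r : option F * 'I_n -> laurent F).
Variable sigma : option F * 'I_n -> {rmorphism K -> laurent F}.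
Hypothesis r_inj : injective r.
Hypotheses (sx : forall i, sigma i x0 = r i) (st : forall i, sigma i t0 = lX F).
Hypothesis sC : forall i b, sigma i (cK b) = laurent_of_poly b%:P.

Let I : finType := (option F * 'I_n)%type.
Let cardI : #|I| = (n * q.+1)%N.
Proof. by rewrite card_prod card_option card_ord mulnC. Qed.

Let trT : transcendental (iota \o (@tofrac {poly F} \o polyC)) T.
Proof. exact/transcendental_morph/transcendental_tofracX. Qed.

Let jcK : (j \o cK) =1 (iota \o (@tofrac {poly F} \o polyC)).
Proof. by move=> b; exact: jC. Qed.

Lemma transcendental_in_K z :
  transcendental (iota \o (@tofrac {poly F} \o polyC)) (j z) <-> transcendental cK z.
Proof.
rewrite -(transcendental_morph cK j z); rewrite /transcendental /algebraicOver.
by split=> H [p p0 pz]; apply: H; exists p => //; move: pz; rewrite (eq_map_poly jcK).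
Qed.

Lemma ratfun_in_K : exists tau : {rmorphism ratfun F -> K},
  [/\ tau (tofrac 'X) = t0, forall b, tau (tofrac b%:P) = cK b
    & forall z, j (tau z) = iota z].
Proof.
have [tau [tX tC]] : exists s : {rmorphism ratfun F -> K},
    s (tofrac 'X) = t0 /\ forall b, s (tofrac b%:P) = cK b.
  by apply: transcendental_ext; apply/transcendental_in_K; rewrite jt.
exists tau; split=> //.
by apply: (@ratfun_morph_eq _ _ (j \o tau) iota) => [|b] /=; rewrite ?tX ?jt ?tC ?jC.
Qed.

Lemma laurent_ratfun : exists phi : {rmorphism ratfun F -> laurent F},
  forall p, phi (tofrac p) = laurent_of_poly p.
Proof. exact: fraction_extension (@laurent_of_poly_inj F). Qed.

Lemma places_over_ratfun (tau : {rmorphism ratfun F -> K})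
    (phi : {rmorphism ratfun F -> laurent F}) :
  tau (tofrac 'X) = t0 -> (forall b, tau (tofrac b%:P) = cK b) ->
  (forall p, phi (tofrac p) = laurent_of_poly p) ->
  forall i (g : {poly ratfun F}),
    sigma i (map_poly tau g).[x0] = (map_poly phi g).[r i].
Proof.
move=> tX tC phiE i g; rewrite -horner_map sx -map_poly_comp; congr _.[_].
apply: eq_map_poly; apply: (@ratfun_morph_eq _ _ (sigma i \o tau) phi) => [|b] /=.
  by rewrite tX st phiE.
by rewrite tC sC phiE.
Qed.

(** Lift the relation to K and push it forward by each place: the images of x are
    n (q + 1) distinct roots. *)
Lemma alpha_degree (g : {poly ratfun F}) :
  g != 0 -> root (map_poly iota g) alpha -> (n * q.+1 < size g)%N.
Proof.
move=> g0 galpha; have [tau [tX tC jtau]] := ratfun_in_K.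
have [phi phiE] := laurent_ratfun.
have gx : (map_poly tau g).[x0] = 0.
  apply: (fmorph_inj j); rewrite rmorph0 -(rootP galpha) -horner_map jx -map_poly_comp.
  by congr _.[_]; apply: eq_map_poly => z; rewrite -jtau.
rewrite -cardI -(size_map_poly phi) cardE -(size_map r); apply: max_poly_roots.
- by rewrite map_poly_eq0.
- apply/allP => _ /mapP[i _ ->]; apply/rootP.
  by rewrite -(places_over_ratfun tX tC phiE) gx rmorph0.
- by rewrite map_inj_uniq ?enum_uniq.
Qed.

Let f : {poly {poly F}} := curve_poly n q 'X.

(** If the polynomial is a product, alpha is a root of one of the two factors,
    which then has full degree by [alpha_degree]. *)
Lemma alpha_minpoly : is_minpoly iota alpha f.
Proof.
have X0 : 'X != 0 :> {poly F} by rewrite polyX_eq0.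
have TX0 : tofrac 'X != 0 :> ratfun F by rewrite tofrac_eq0.
have [sz lf] := curve_poly_size_lead n0 q1 X0.
have [szT _] := curve_poly_size_lead n0 q1 TX0.
have fT : map_poly (@tofrac {poly F}) f = curve_poly n q (tofrac 'X).
  exact: map_curve_poly.
have fa : root (map_poly iota (map_poly (@tofrac {poly F}) f)) alpha.
  by rewrite fT map_curve_poly; apply/root_curve_poly.
split.
- have p0 : map_poly (@tofrac {poly F}) f != 0 by rewrite fT curve_poly_neq0.
  have szp : size (map_poly (@tofrac {poly F}) f) = (n * q.+1).+1 by rewrite fT.
  split=> [|g g1 gp]; first by rewrite szp ltnS muln_gt0 n0.
  have pn0 := p0; have /dvdpP[s sE] := gp; rewrite sE mulf_eq0 negb_or in p0.
  have [s0 g0] := andP p0.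
  move: fa; rewrite sE rmorphM rootM => /orP[/(alpha_degree s0)|/(alpha_degree g0)] sz'.
    have := szp; rewrite sE size_mul // => szsg.
    case/eqP: g1; apply/eqP; rewrite eqn_leq size_poly_gt0 g0 andbT.
    rewrite -(leq_add2l (size s)) addn1 (leq_trans (leqSpred _)) // szsg.
    by rewrite ltnS.
  rewrite -sE -(dvdp_size_eqp gp); by rewrite eqn_leq (dvdp_leq pn0 gp) szp.
- by rewrite map_poly_comp.
- exact: curve_poly_primitive.
by rewrite lf monicXn.
Qed.

Lemma curve_poly_splits : splits_over_laurent f.
Proof.
have [sz lf] := curve_poly_size_lead n0 q1 (lX_neq0 F).
exists (codom r).
have -> : map_poly (@laurent_of_poly F) f = curve_poly n q (lX F).
  exact: map_curve_poly.
rewrite [X in X %= _](@all_roots_prod_XsubC _ _ (codom r)).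
- by rewrite eqp_scale // lf expf_neq0 // lX_neq0.
- by rewrite sz size_codom cardI.
- apply/allP => _ /codomP[i ->]; apply/root_curve_poly.
  rewrite -sx -(st i); apply: on_curve_morph.
  by apply: (@on_curve_morph_inj _ _ j); rewrite jx jt.
by rewrite uniq_rootsE; apply/injectiveP.
Qed.

Lemma alpha_height : has_height iota alpha (1 / q.+1%:R).
Proof.
exists f; first exact: alpha_minpoly.
have [sz _] := curve_poly_size_lead n0 q1 (negbT (polyX_eq0 F)).
rewrite /deg_T /deg_x (sizeY_curve_poly n0 q1) sz /= natrM invfM mulrA mulfV //.
by rewrite Num.Theory.pnatr_eq0 -lt0n.
Qed.

Lemma function_field_range z : function_field iota alpha z -> exists x, j x = z.
Proof.
apply: subfield_gen_range => [b|_ [->|->]]; first by exists (cK b); exact: jC.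
  by exists t0.
by exists x0.
Qed.

Lemma range_function_field x : function_field iota alpha (j x).
Proof.
have [p _ ->] := K_gen x; rewrite -horner_map -map_poly_comp jt.
apply: (@subfield_gen_horner _ _ _ _ _ (j \o e)) => [b|]; last first.
  by apply: subfield_gen_incl; left.
apply: (@subfield_gen_ratfun _ _ _ _ (j \o e)) => [d|]; first exact: jC.
by rewrite /= -/x0 jx; apply: subfield_gen_incl; right.
Qed.

(** The coordinate x is a function of degree n. *)
Lemma gonality_le : has_map_of_degree iota alpha n.
Proof.
exists alpha; split.
- by apply: subfield_gen_incl; right.
- exact: curve_transcendental n0 alpha_curve trT.
exists (fun i => T ^+ i) => [i|z /function_field_range[x <-]].
  by rewrite -jt -rmorphXn; apply: range_function_field.
have value (d : 'I_n -> ratfun F) : \sum_(i < n) j (e (d i)) * T ^+ i =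
    j (map_poly e (\poly_(i < n) (if insub i is Some i' then d i' else 0))).[t0].
  rewrite (@horner_coef_wide _ n) ?size_map_poly ?size_poly // rmorph_sum.
  apply: eq_bigr => i _; rewrite coef_map coef_poly ltn_ord valK /=.
  by rewrite rmorphM rmorphXn jt.
have [p pn ->] := K_gen x.
exists [ffun i : 'I_n => j (e p`_i)]; split=> [|c' [c'E c'z]].
  split=> [i|]; rewrite ?ffunE.
    apply: (@subfield_gen_ratfun _ _ _ _ (j \o e)) => [d|]; first exact: jC.
    by rewrite /= -/x0 jx; apply: subfield_gen_incl.
  rewrite (@horner_coef_wide _ n) ?size_map_poly // rmorph_sum.
  by apply: eq_bigr => i _; rewrite ffunE coef_map rmorphM rmorphXn jt.
have ex i : exists d, j (e d) = c' i.
  apply: (@subfield_gen_range _ _ _ _ (j \o e)) (c'E i) => [b|_ ->].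
    by exists (tofrac b%:P); exact: jC.
  by exists (tofrac 'X); exact: jx.
have [d dE] := choice ex.
apply/ffunP => i; rewrite ffunE -dE; congr (j (e _)).
move: c'z; under eq_bigr do rewrite -dE.
rewrite value => /(fmorph_inj j)/eqP; rewrite -subr_eq0 -hornerN -hornerD -rmorphB.
move/eqP/K_free => pd; rewrite [p](subr0_eq (pd _)).
  by rewrite coef_poly ltn_ord valK.
by rewrite (leq_trans (size_polyD _ _)) // geq_max size_polyN pn size_poly.
Qed.

(** With d < n there would be d + 1 elements, independent over F(psi), in a space
    of dimension d: the d + 1 rows of their coordinates, which lie in F(psi),
    have a nontrivial relation with coefficients in F(psi). *)
Lemma gonality_ge d : has_map_of_degree iota alpha d -> (n <= d)%N.
Proof.
case=> phi0 [/function_field_range[psi <-] trpsi [b bK basis]].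
rewrite leqNgt; apply/negP => dn.
have trK : transcendental cK psi by apply/transcendental_in_K.
have dI : (d * q.+1 < #|I|)%N by rewrite cardI ltn_mul2r.
have [J [s s_inj [JC [y Jy] zeros]]] := @many_zeros F K cK I sigma sC psi d dI trK.
have [tau [tX tC _]] := ratfun_in_K; have [phi phiE] := laurent_ratfun.
have [B BP] := choice (separating_polys phiE (inj_comp r_inj s_inj)).
pose beta i := (map_poly tau (B i)).[x0].
have JX0 : J (tofrac 'X) != 0 by rewrite fmorph_eq0 tofrac_eq0 polyX_eq0.
have indep := ratfun_independent (fun i => sC (s i)) JX0 zeros _ (erefl _) JC.
have beta_res i k : has_residue (sigma (s i) (beta k)) (i == k)%:R.
  by rewrite /beta (places_over_ratfun tX tC phiE); apply: BP.
have row i : exists m : 'I_d -> ratfun F, j (beta i) = \sum_l j (J (m l)) * b l.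
  have [c [[cE cz] _]] := basis _ (range_function_field (beta i)).
  have ex l : exists u, j (J u) = c l.
    apply: (@subfield_gen_range _ _ _ _ (j \o J)) (cE l) => [a|_ ->].
      by exists (tofrac a%:P); rewrite /= JC; exact: jC.
    by exists y; rewrite /= Jy.
  have [m mE] := choice ex; exists m; rewrite cz.
  by apply: eq_bigr => l _; rewrite mE.
have [m mE] := choice row.
pose A : 'M[ratfun F]_(d.+1, d) := \matrix_(i, l) m i l.
have [v v0 vA] : exists2 v : 'rV_d.+1, v != 0 & v *m A = 0.
  have : kermx A != 0.
    by rewrite -mxrank_eq0 mxrank_ker subn_eq0 -ltnNge ltnS rank_leq_col.
  by case/rowV0Pn => v /sub_kermxP vA v0; exists v.
case/negP: v0; apply/eqP/rowP => i; rewrite mxE.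
apply: (indep beta beta_res (fun i => v 0 i)).
apply: (fmorph_inj j); rewrite rmorph0 rmorph_sum /=.
transitivity (\sum_l j (J ((v *m A) 0 l)) * b l); last first.
  by rewrite big1 // => l _; rewrite vA mxE !rmorph0 mul0r.
under eq_bigr do rewrite rmorphM mE mulr_sumr.
rewrite exchange_big; apply: eq_bigr => l _; rewrite mxE !rmorph_sum mulr_suml.
by apply: eq_bigr => k _; rewrite mxE !rmorphM mulrA.
Qed.

End Main.

Theorem theorem4p5 (n q : nat) (F : finFieldType)
  (hn : (1 <= n)%N) (hF : #|F| = q) (hq : q = 1 %[mod n])
  (Omega : closedFieldType) (iota : {rmorphism ratfun F -> Omega})
  (hOmega : forall z : Omega, algebraicOver iota z)
  (alpha : Omega) :
  let T : ratfun F := @tofrac {poly F} 'X in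
  root (map_poly iota
    ((T ^+ n)%:P * 'X^n * ('X^q - 'X) ^+ n - ('X^q - 'X) ^+ n + (T ^+ n)%:P))
    alpha ->
  [/\ totally_Tadic iota alpha,
      has_height iota alpha (1 / q.+1%:R)
    & has_gonality iota alpha n].
Proof.
move=> T; subst q => /=; rewrite map_curve_poly => /root_curve_poly alpha_curve.
have [zeta zeta_prim] := finField_prim_root hn hq.
have [K [e [t0 [t0_curve K_gen K_free K_ext]]]] := curve_function_field zeta_prim.
have trT : transcendental (iota \o (@tofrac {poly F} \o polyC)) (iota T).
  exact/transcendental_morph/transcendental_tofracX.
have [j [jx jt je]] := K_ext _ _ _ _ alpha_curve trT.
have jC b : j ((e \o (@tofrac {poly F} \o polyC)) b) = const_embed iota b by exact: je.
have [r [r_inj r_curve]] := curve_points zeta_prim.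
have place i := K_ext _ _ _ _ (r_curve i) (@transcendental_lX F).
have [sigma sigmaP] := choice place.
have sx i : sigma i (e (tofrac 'X)) = r i by have [] := sigmaP i.
have st i : sigma i t0 = lX F by have [] := sigmaP i.
have sC i b : sigma i ((e \o (@tofrac {poly F} \o polyC)) b) = laurent_of_poly b%:P.
  by have [_ _ sigmaC] := sigmaP i; exact: sigmaC.
split.
- exists (curve_poly n #|F| 'X).
    exact (alpha_minpoly zeta_prim alpha_curve jx jt jC r_inj sx st sC).
  exact (curve_poly_splits zeta_prim alpha_curve jx jt r_inj sx st).
- exact (alpha_height zeta_prim alpha_curve jx jt jC r_inj sx st sC).
split; first exact (gonality_le zeta_prim alpha_curve K_gen K_free jx jt jC).
exact (gonality_ge K_gen jx jt jC r_inj sx st sC).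
Qed.
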